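(* Let $A$ be a Noetherian ring and let $\mathcal{R}\subseteq\mathcal{S}$ be an inclusion of graded rings, where $\mathcal{R},\mathcal{S}$ are standard graded with $\mathcal{R}_0=\mathcal{S}_0=A$. Let $M$ be a finitely generated graded $\mathcal{R}$-module and $N$ a finitely generated graded $\mathcal{S}$-module with an inclusion $M\subseteq N$ of graded $\mathcal{R}$-modules. Then: (1) $\operatorname{Ass}_A(N/M)$ is a finite set. (2) If $A$ is local and $\ell_A(N_n/M_n)<\infty$ for all $n$, then there is a polynomial $P(z)\in\mathbb{Q}[z]$ of degree at most $\dim\mathcal{S}-1$ with $P(n)=\ell_A(N_n/M_n)$ for all $n\gg0$.
   Context: A standard graded ring $\mathcal{R}=\bigoplus_{n\ge0}\mathcal{R}_n$ with $\mathcal{R}_0=A$ is a Noetherian $\mathbb{N}$-graded commutative ring generated as an $A$-algebra by finitely many elements of $\mathcal{R}_1$. $N/M$ is regarded as an $A$-module; $\ell_A$ denotes length. *)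

(* Defs.v *)
From HB Require Import structures.
From mathcomp Require Import all_boot all_order all_algebra.
Set Implicit Arguments. Unset Strict Implicit. Unset Printing Implicit Defensive.
Import Order.TTheory GRing.Theory Num.Theory.
Local Open Scope ring_scope.

Definition addsubgroup (V : zmodType) (P : V -> Prop) : Prop :=
  P 0 /\ forall x y, P x -> P y -> P (x - y).

Definition direct_decomp (I : eqType) (V : zmodType) (G : I -> V -> Prop) : Prop :=
  (forall v : V, exists (s : seq I) (c : I -> V),
      (forall i, G i (c i)) /\ v = \sum_(i <- s) c i) /\
  (forall (s : seq I) (c : I -> V), uniq s -> (forall i, G i (c i)) ->
      \sum_(i <- s) c i = 0 -> forall i, i \in s -> c i = 0).

Definition ideal (A : comRingType) (I : A -> Prop) : Prop :=
  addsubgroup I /\ forall a x, I x -> I (a * x).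

Definition prime_ideal (A : comRingType) (p : A -> Prop) : Prop :=
  ideal p /\ ~ p 1 /\ forall a b, p (a * b) -> p a \/ p b.

Definition fg_ideal (A : comRingType) (I : A -> Prop) : Prop :=
  exists gs : seq A, forall x,
    I x <-> exists r : nat -> A, x = \sum_(i < size gs) r i * gs`_i.

Definition noetherian (A : comRingType) : Prop :=
  forall I : A -> Prop, ideal I -> fg_ideal I.

Definition local_ring (A : comRingType) : Prop :=
  exists m : A -> Prop, ideal m /\ ~ m 1 /\
    forall I, ideal I -> ~ I 1 -> forall x, I x -> m x.

Definition strict_incl (T : Type) (P Q : T -> Prop) : Prop :=
  (forall x, P x -> Q x) /\ exists x, Q x /\ ~ P x.

Definition krull_dim_ge (A : comRingType) (k : nat) : Prop :=
  exists c : nat -> A -> Prop,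
    (forall i, (i <= k)%N -> prime_ideal (c i)) /\
    (forall i, (i < k)%N -> strict_incl (c i) (c i.+1)).

Definition graded_ring (S : comRingType) (Sg : nat -> S -> Prop) : Prop :=
  (forall n, addsubgroup (Sg n)) /\ direct_decomp Sg /\ Sg 0%N 1 /\
  forall i j x y, Sg i x -> Sg j y -> Sg (i + j)%N (x * y).

Inductive alg_gen (S : comRingType) (A : S -> Prop) (xs : seq S) : S -> Prop :=
| alg_gen_base a : A a -> alg_gen A xs a
| alg_gen_var x : x \in xs -> alg_gen A xs x
| alg_gen_sub x y : alg_gen A xs x -> alg_gen A xs y -> alg_gen A xs (x - y)
| alg_gen_mul x y : alg_gen A xs x -> alg_gen A xs y -> alg_gen A xs (x * y).

Definition standard_graded (S : comRingType) (Sg : nat -> S -> Prop) : Prop :=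
  noetherian S /\ graded_ring Sg /\
  exists xs : seq S, (forall x, x \in xs -> Sg 1%N x) /\
    forall s, alg_gen (Sg 0%N) xs s.

Definition graded_module (S : comRingType) (Sg : nat -> S -> Prop)
    (N : lmodType S) (Ng : int -> N -> Prop) : Prop :=
  (forall n, addsubgroup (Ng n)) /\ direct_decomp Ng /\
  forall (i : nat) (n : int) s x, Sg i s -> Ng n x -> Ng (i%:Z + n) (s *: x).

Definition fg_module (S : comRingType) (N : lmodType S) : Prop :=
  exists gs : seq N, forall x : N,
    exists r : nat -> S, x = \sum_(i < size gs) r i *: gs`_i.

Definition submod_act (A : comRingType) (V : zmodType) (act : A -> V -> V)
    (L : V -> Prop) : Prop :=
  addsubgroup L /\ forall a x, L x -> L (act a x).

Definition chain_of_length (A : comRingType) (V : zmodType) (act : A -> V -> V)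
    (lo hi : V -> Prop) (k : nat) : Prop :=
  exists c : nat -> V -> Prop,
    (forall i, (i <= k)%N -> submod_act act (c i)) /\
    (forall x, lo x -> c 0%N x) /\ (forall x, c k x -> hi x) /\
    (forall i, (i < k)%N -> strict_incl (c i) (c i.+1)).

(** the A-module hi/lo (lo <= hi submodules) has length exactly l *)
Definition quot_length (A : comRingType) (V : zmodType) (act : A -> V -> V)
    (lo hi : V -> Prop) (l : nat) : Prop :=
  chain_of_length act lo hi l /\
  forall k, chain_of_length act lo hi k -> (k <= l)%N.

Definition ass_quot (A : comRingType) (V : zmodType) (act : A -> V -> V)
    (Msub : V -> Prop) (p : A -> Prop) : Prop :=
  prime_ideal p /\ exists x : V, forall a, p a <-> Msub (act a x).

(* Main.v *)
(** Fix generators [x] of [R_1] and [y] of [S_1].  Filter each [N_n] by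
    [F_0 = M_n] and [F_(i+1) = F_i + (products of some x's and i y's) G], where [G] consists of
    homogeneous generators of [N] and of the elements [y h], [h] a generator of [M].  Then [x] maps
    [F_i] to [F_i], [y] maps [F_i] to [F_(i+1)], and the associated graded module of [N / M] is
    finitely generated over the polynomial ring [A[X, Y]], hence Noetherian.  This gives the
    finiteness of its associated primes, which include those of [N / M], and a Hilbert polynomial.

    For the degree, let [m] be the maximal ideal of [A] and [Q = m + S_+].  Some power [m^l] kills
    [G] modulo [M], so [m^(l i) F_i <= M] and, as [N_n = F_(n+c)], the space [N_n / M_n] is a
    quotient of [N_n / m^(l (n+c)) N_n].  Summing over [n], the lengths are bounded by the length of
    [N / Q^K N] for some [K] linear in [n].  By Noetherian induction on an ideal [I], the length of
    [S / (I + Q^K)] is [O(K^d)] for the length [d] of some chain of primes above [I]: if [I] is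
    prime, multiplication by some [x] in [Q] outside [I] compares it with [I + (x)]. *)

From HB Require Import structures.
From mathcomp Require Import all_boot all_order all_algebra.
From mathcomp Require Import boolp functions zify ring lra.
From mathcomp Require polyrcf.
Require Import Defs.
Set Implicit Arguments. Unset Strict Implicit. Unset Printing Implicit Defensive.
Import Order.TTheory GRing.Theory Num.Theory.
Local Open Scope ring_scope.

(** * Additive subgroups *)

(** The obstacle is that [M] is stable under [R] only: [S] does not act on [N / M], and [N] need not
    be finitely generated over [R], so [N / M] itself need not be Noetherian. The elements [y h]
    join the generators so that [y M] already falls into the first step of the filtration. No
    quotient and no polynomial ring is formed. A graded subquotient is a pair of families [lo <= hi]
    indexed by the degree, a module over the polynomial ring is such a pair with a list of commuting
    operators of degree one, and lengths are those of chains between [lo] and [hi]. The degree bound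
    compares sums over the window from [n] to [2 n - 1]: a polynomial of degree [e] sums to order
    [n ^ (e + 1)], against an upper bound of order [n ^ d]. Hence [e + 1 <= d], which is the origin
    of the [- 1]; the integer [d] comes with an explicit chain of primes of [S]. *)

Section AddSubgroup.
Variables (V : zmodType) (P : V -> Prop).
Hypothesis sgP : addsubgroup P.

Lemma addsubgroup0 : P 0. Proof. by case: sgP. Qed.

Lemma addsubgroupB x y : P x -> P y -> P (x - y). Proof. by case: sgP => _; apply. Qed.

Lemma addsubgroupN x : P x -> P (- x).
Proof. by rewrite -sub0r; apply: addsubgroupB; apply: addsubgroup0. Qed.

Lemma addsubgroupD x y : P x -> P y -> P (x + y).
Proof. by move=> Px Py; rewrite -[y]opprK; apply/addsubgroupB/addsubgroupN. Qed.

Lemma addsubgroup_sum (I : Type) (s : seq I) (Q : pred I) (F : I -> V) :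
  (forall i, Q i -> P (F i)) -> P (\sum_(i <- s | Q i) F i).
Proof. by move=> PF; elim/big_ind: _ => //; [apply: addsubgroup0 | apply: addsubgroupD]. Qed.

Lemma addsubgroup_subK x y : P (x - y) -> P y -> P x.
Proof. by move=> Pxy Py; rewrite -(subrK y x); apply: addsubgroupD. Qed.

Lemma addsubgroup_subKr x y : P (x - y) -> P x -> P y.
Proof. by move=> Pxy Px; rewrite -[y](subKr x); apply: addsubgroupB. Qed.

End AddSubgroup.

Definition sum_pred (V : zmodType) (P Q : V -> Prop) (v : V) :=
  exists x y, [/\ P x, Q y & v = x + y].

Definition full_pred (V : Type) (_ : V) := True.

Definition sub_morph (U V : zmodType) (f : U -> V) := forall x y, f (x - y) = f x - f y.

Section SubMorph.
Variables (U V : zmodType) (f : U -> V).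
Hypothesis fB : sub_morph f.

Lemma sub_morph0 : f 0 = 0. Proof. by rewrite -(subrr 0) fB subrr. Qed.

Lemma sub_morphN x : f (- x) = - f x. Proof. by rewrite -sub0r fB sub_morph0 sub0r. Qed.

Lemma sub_morphD x y : f (x + y) = f x + f y.
Proof. by rewrite -[y in LHS]opprK fB sub_morphN opprK. Qed.

Lemma sub_morph_sum (I : Type) (s : seq I) (Q : pred I) (F : I -> U) :
  f (\sum_(i <- s | Q i) F i) = \sum_(i <- s | Q i) f (F i).
Proof. exact: (big_morph f sub_morphD sub_morph0). Qed.

End SubMorph.

Section SumPred.
Variables (V : zmodType) (P Q : V -> Prop).
Hypotheses (sgP : addsubgroup P) (sgQ : addsubgroup Q).

Lemma sum_predl x : P x -> sum_pred P Q x.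
Proof. by exists x, 0; rewrite addr0; split=> //; apply: addsubgroup0. Qed.

Lemma sum_predr x : Q x -> sum_pred P Q x.
Proof. by exists 0, x; rewrite add0r; split=> //; apply: addsubgroup0. Qed.

Lemma addsubgroup_sum_pred : addsubgroup (sum_pred P Q).
Proof.
split; first by apply: sum_predl; apply: addsubgroup0.
move=> _ _ [x [y [Px Qy ->]]] [x' [y' [Px' Qy' ->]]].
exists (x - x'), (y - y'); split; [exact: addsubgroupB | exact: addsubgroupB |].
by rewrite opprD addrACA.
Qed.

End SumPred.

(** * Lengths of subquotients *)

Section Length.
Variables (A : comRingType) (V : zmodType) (act : A -> V -> V).
Hypothesis actB : forall a, sub_morph (act a).
Local Notation submod := (submod_act act).
Local Notation chain := (chain_of_length act).

Definition length_le (lo hi : V -> Prop) (b : nat) :=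
  forall k, chain lo hi k -> (k <= b)%N.

Lemma submod_sum_pred P Q : submod P -> submod Q -> submod (sum_pred P Q).
Proof.
move=> [sgP aP] [sgQ aQ]; split; first exact: addsubgroup_sum_pred.
move=> a _ [x [y [Px Qy ->]]]; exists (act a x), (act a y).
by rewrite (sub_morphD (actB a)); split; [apply: aP | apply: aQ |].
Qed.

Lemma submodI P Q : submod P -> submod Q -> submod (fun x => P x /\ Q x).
Proof.
move=> [sgP aP] [sgQ aQ]; split; first split.
- by split; apply: addsubgroup0.
- by move=> x y [? ?] [? ?]; split; apply: addsubgroupB.
by move=> a x [? ?]; split; [apply: aP | apply: aQ].
Qed.

Lemma chain_mono (c : nat -> V -> Prop) k :
  (forall i, (i < k)%N -> strict_incl (c i) (c i.+1)) ->
  forall i j, (i <= j <= k)%N -> forall x, c i x -> c j x.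
Proof.
move=> cS i; elim=> [|j IHj] /andP[]; first by rewrite leqn0 => /eqP->.
rewrite leq_eqVlt ltnS => /predU1P[-> //|le_ij lt_jk] x cx.
by apply: (cS j lt_jk).1; apply: IHj => //; rewrite le_ij ltnW.
Qed.

Lemma chain0 lo hi : submod lo -> (forall x, lo x -> hi x) -> chain lo hi 0.
Proof. by move=> slo lohi; exists (fun=> lo); split=> //; split. Qed.

Lemma chain_sub lo hi lo' hi' k : (forall x, lo' x -> lo x) -> (forall x, hi x -> hi' x) ->
  chain lo hi k -> chain lo' hi' k.
Proof.
by move=> l h [c [c1 [c2 [c3 c4]]]]; exists c; split=> //; split=> [x /l/c2//|]; split=> // x /c3/h.
Qed.

Lemma chain_cat lo mid mid' hi a b : (forall x, mid x -> mid' x) ->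
  chain lo mid a -> chain mid' hi b -> chain lo hi (a + b).
Proof.
move=> mm [c [c1 [c2 [c3 c4]]]] [d [d1 [d2 [d3 d4]]]].
(* At the junction [c a] is kept and [d 0] is dropped; as [c a] lies in [d 0], the step from [c a]
   to [d 1] stays strict. *)
pose e i := if (i <= a)%N then c i else d (i - a)%N.
have cd x : c a x -> d 0%N x by move=> /c3/mm/d2.
exists e; split; last split; last split.
- by move=> i iab; rewrite /e; case: leqP => ia; [apply: c1 | apply: d1; rewrite leq_subLR].
- by move=> x /c2.
- move=> x; rewrite /e; case: leqP => [|_]; last by rewrite addKn => /d3.
  rewrite -{2}[a]addn0 leq_add2l leqn0 => /eqP b0; rewrite b0 addn0 in d3 * => /cd.
  exact: d3.
move=> i iab; rewrite /e; case: (ltnP i a) => ia; first by rewrite (ltnW ia); apply: c4.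
have idx : (i.+1 - a = (i - a).+1)%N by rewrite subSn.
have lt : (i - a < b)%N by rewrite ltn_subLR.
have [dS [x [dx ndx]]] := d4 _ lt.
rewrite idx; case: (leqP i a) => ia'; last by split=> //; exists x.
have ei : i = a by apply/eqP; rewrite eqn_leq ia ia'.
rewrite ei subnn in dS dx ndx *.
by split=> [y /cd/dS //|]; exists x; split=> // /cd.
Qed.

Lemma chain_rcons lo P Q n : submod P -> submod Q -> strict_incl P Q ->
  chain lo P n -> chain lo Q n.+1.
Proof.
move=> sP sQ PQ cP; rewrite -addn1; apply: (chain_cat (mid' := P)) cP _ => //.
exists (fun i => if i is 0%N then P else Q).
by split=> [[|i] //|]; split=> //; split=> // -[].
Qed.

(* A strict step of a chain stays strict in the trace on [mid] or in the image modulo [mid]. *)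
Lemma length_le_add lo mid hi a b : submod lo ->
  submod mid -> submod hi -> (forall x, lo x -> mid x) -> (forall x, mid x -> hi x) ->
  length_le lo mid a -> length_le mid hi b -> length_le lo hi (a + b).
Proof.
move=> slo smid [sghi _] lm mh la lb k [c [c1 [c2 [c3 c4]]]].
have sI i : (i <= k)%N -> submod (fun x => c i x /\ mid x).
  by move=> ?; apply: submodI => //; apply: c1.
have sS i : (i <= k)%N -> submod (sum_pred mid (c i)).
  by move=> ?; apply: submod_sum_pred => //; apply: c1.
suff H i : (i <= k)%N -> exists a' b', [/\ chain lo (fun x => c i x /\ mid x) a',
    chain mid (sum_pred mid (c i)) b' & (i <= a' + b')%N].
  have [a' [b' [ca cb le]]] := H k (leqnn k).
  apply: (leq_trans le); apply: leq_add; first by apply: la; apply: chain_sub ca => // x [].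
  apply: lb; apply: chain_sub cb => // _ [x [y [/mh hx /c3 hy ->]]].
  exact: addsubgroupD.
elim: i => [_|i IHi ik].
  exists 0%N, 0%N; split=> //; apply: chain0 => //; first by move=> x lx; split; auto.
  by move=> x mx; apply: sum_predl => //; case: (c1 0%N (leq0n k)).
have [a' [b' [ca cb le]]] := IHi (ltnW ik).
have [cS [x [cx ncx]]] := c4 i ik.
have [sgi _] := c1 i (ltnW ik); have [sgi1 _] := c1 i.+1 ik.
have [sgm _] := smid.
have IS z : sum_pred mid (c i) z -> sum_pred mid (c i.+1) z.
  by case=> u [v [mu cv ->]]; exists u, v; split=> //; apply: cS.
have II z : c i z /\ mid z -> c i.+1 z /\ mid z by case=> /cS.
(* If [x = u + v] with [u] in [mid] and [v] in [c i], then [u] makes the trace grow; otherwise [x]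
   makes the image grow. *)
case: (EM (sum_pred mid (c i) x)) => [[u [v [mu cv ex]]]|nx].
  exists a'.+1, b'; rewrite addSn ltnS; split=> //; last exact: chain_sub cb.
  apply: chain_rcons ca; [exact: sI (ltnW _)| exact: sI|split=> //].
  have eu : u = x - v by rewrite ex addrK.
  exists u; split; first by split=> //; rewrite eu; apply: addsubgroupB => //; apply: cS.
  by case=> cu _; apply: ncx; rewrite ex; apply: addsubgroupD.
exists a', b'.+1; rewrite addnS ltnS; split=> //; first exact: chain_sub ca.
apply: chain_rcons cb; [exact: sS (ltnW _)|exact: sS|split=> //].
by exists x; split=> //; apply: sum_predr.
Qed.

Lemma quot_length_exists lo hi b : submod lo -> (forall x, lo x -> hi x) ->
  length_le lo hi b -> exists l, quot_length act lo hi l.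
Proof.
move=> slo lh lb.
have ex : exists n, (fun n => `[< chain lo hi n >]) n by exists 0%N; apply/asboolP; exact: chain0.
have ub n : `[< chain lo hi n >] -> (n <= b)%N by move=> /asboolP/lb.
case: (ex_maxnP ex ub) => l /asboolP cl lmax.
by exists l; split=> // k ck; apply: lmax; apply/asboolP.
Qed.

Lemma quot_length_unique lo hi l l' :
  quot_length act lo hi l -> quot_length act lo hi l' -> l = l'.
Proof. by case=> c m [c' m']; apply/eqP; rewrite eqn_leq m // m'. Qed.

Lemma quot_length_add lo mid hi a b : submod lo ->
  submod mid -> submod hi -> (forall x, lo x -> mid x) -> (forall x, mid x -> hi x) ->
  quot_length act lo mid a -> quot_length act mid hi b -> quot_length act lo hi (a + b).
Proof.
move=> slo smid shi lm mh [ca la] [cb lb]; split; last exact: length_le_add lm mh la lb.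
exact: chain_cat ca cb.
Qed.

Lemma quot_length_split lo mid hi l : submod lo ->
  submod mid -> submod hi -> (forall x, lo x -> mid x) -> (forall x, mid x -> hi x) ->
  quot_length act lo hi l -> exists a b,
    [/\ quot_length act lo mid a, quot_length act mid hi b & l = (a + b)%N].
Proof.
move=> slo smid shi lm mh ql.
have [a qa] : exists a, quot_length act lo mid a.
  by apply: (@quot_length_exists _ _ l) => // k /(chain_sub (fun x h => h) mh)/ql.2.
have [b qb] : exists b, quot_length act mid hi b.
  by apply: (@quot_length_exists _ _ l) => // k /(chain_sub lm (fun x h => h))/ql.2.
exists a, b; split=> //; apply: quot_length_unique ql _.
exact: quot_length_add qa qb.
Qed.

Lemma quot_length_refl lo hi : submod lo -> (forall x, lo x -> hi x) ->
  (forall x, hi x -> lo x) -> quot_length act lo hi 0.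
Proof.
move=> slo lh hl; split; first exact: chain0.
case=> // k [c [c1 [c2 [c3 c4]]]].
have [_ [x [cx []]]] := c4 0%N isT.
by apply/c2/hl/c3; apply: (chain_mono c4 _ cx); rewrite ltn0Sn leqnn.
Qed.

Lemma length_le_refl lo hi : submod lo -> (forall x, lo x -> hi x) ->
  (forall x, hi x -> lo x) -> length_le lo hi 0.
Proof. by move=> slo lh hl; case: (quot_length_refl slo lh hl). Qed.

Lemma length_le_leq lo hi b b' : (b <= b')%N -> length_le lo hi b -> length_le lo hi b'.
Proof. by move=> bb lb k /lb kb; apply: leq_trans bb. Qed.

Lemma quot_length_ext lo hi lo' hi' l : (forall x, lo x <-> lo' x) -> (forall x, hi x <-> hi' x) ->
  quot_length act lo hi l -> quot_length act lo' hi' l.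
Proof.
move=> el eh [c m]; split; first by apply: chain_sub c => x; [rewrite el | rewrite eh].
by move=> k ck; apply: m; apply: chain_sub ck => x; [rewrite el | rewrite eh].
Qed.

End Length.

Section LengthMorphism.
Variables (A : comRingType) (U V : zmodType) (actU : A -> U -> U) (actV : A -> V -> V).
Variable f : U -> V.
Hypotheses (fB : sub_morph f) (fact : forall a x, f (actU a x) = actV a (f x)).
Hypothesis actVB : forall a, sub_morph (actV a).
Variables (lo hi : U -> Prop) (lo' hi' : V -> Prop).
Hypothesis shi : submod_act actU hi.
Hypothesis flo : forall x, lo x -> hi x /\ lo' (f x).
Hypothesis fhi : forall y, hi' y -> exists2 x, hi x & lo' (y - f x).

(** Steps pulled back along [f] stay strict because [f] hits all of [hi'] modulo [lo']; so lengths
    can only drop along a surjection. *)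
Lemma chain_preim k : chain_of_length actV lo' hi' k -> chain_of_length actU lo hi k.
Proof.
move=> [c [c1 [c2 [c3 c4]]]]; exists (fun i x => hi x /\ c i (f x)).
have [sghi ahi] := shi.
split.
  move=> i ik; have [[sg0 sgB] ac] := c1 i ik; split; first split.
  - by split; [apply: addsubgroup0 | rewrite (sub_morph0 fB)].
  - by move=> x y [hx cx] [hy cy]; rewrite fB; split; [apply: addsubgroupB | apply: sgB].
  by move=> a x [hx cx]; split; [apply: ahi | rewrite fact; apply: ac].
split; first by move=> x /flo[hx /c2].
split; first by move=> x [].
move=> i ik; have [cS [y [cy ncy]]] := c4 i ik; split; first by move=> x [hx /cS].
have hy : hi' y by apply: c3; apply: (chain_mono c4 _ cy); rewrite ik leqnn.
have [x hx lyx] := fhi hy; exists x; have [sgi _] := c1 i (ltnW ik).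
have cyx : c i (y - f x) by apply: (chain_mono c4 (i := 0) _ (c2 _ lyx)); rewrite leq0n ltnW.
have [sgi1 _] := c1 i.+1 ik.
split; first by split=> //; apply: (addsubgroup_subKr sgi1 _ cy); apply: cS.
by case=> _ cfx; apply: ncy; apply: (addsubgroup_subK sgi cyx).
Qed.

Lemma length_le_image b : length_le actU lo hi b -> length_le actV lo' hi' b.
Proof. by move=> lb k /chain_preim/lb. Qed.

Hypothesis flo_inv : forall x, hi x -> lo' (f x) -> lo x.
Hypothesis fhi_inv : forall x, hi x -> hi' (f x).
Hypotheses (slo' : submod_act actV lo') (shi' : submod_act actV hi').
Hypothesis lohi' : forall y, lo' y -> hi' y.

(** The terms are images enlarged by [lo']; they stay distinct because an element of [hi] sent into
    [lo'] already lies in [lo]. *)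
Lemma chain_image k : chain_of_length actU lo hi k -> chain_of_length actV lo' hi' k.
Proof.
move=> [c [c1 [c2 [c3 c4]]]].
have chi i : (i <= k)%N -> forall x, c i x -> hi x.
  by move=> ik x cx; apply: c3; apply: (chain_mono c4 _ cx); rewrite ik leqnn.
exists (fun i y => exists2 x, c i x & lo' (y - f x)).
have [[lo'0 lo'B] lo'a] := slo'; have [sghi _] := shi.
split.
  move=> i ik; have [[sg0 sgB] ac] := c1 i ik; split; first split.
  - by exists 0 => //; rewrite (sub_morph0 fB) subrr.
  - move=> y y' [x cx lx] [x' cx' lx']; exists (x - x'); first exact: sgB.
    have -> : y - y' - f (x - x') = (y - f x) - (y' - f x') by rewrite fB !opprD !opprK addrACA.
    exact: lo'B.
  move=> a y [x cx lx]; exists (actU a x); first exact: ac.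
  by rewrite fact -actVB; apply: lo'a.
split.
  move=> y ly; exists 0; last by rewrite (sub_morph0 fB) subr0.
  by have [sg0 _] := c1 0%N (leq0n k); apply: addsubgroup0.
split.
  move=> y [x cx lx]; have [sghi' _] := shi'.
  by apply: (addsubgroup_subK sghi' (lohi' lx)); apply: fhi_inv; apply: c3.
move=> i ik; have [cS [x [cx ncx]]] := c4 i ik.
split; first by move=> y [z cz lz]; exists z => //; apply: cS.
exists (f x); split; first by exists x => //; rewrite subrr.
case=> z cz; rewrite -fB => /flo_inv lz; apply: ncx.
have hz := chi _ (ltnW ik) _ cz; have hx := chi _ ik _ cx.
have [sgi _] := c1 i (ltnW ik); apply: (addsubgroup_subK sgi _ cz).
have /lz/c2 : hi (x - z) by apply: addsubgroupB.
by apply: (chain_mono c4); rewrite leq0n ltnW.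
Qed.

Lemma quot_length_iso l : quot_length actU lo hi l <-> quot_length actV lo' hi' l.
Proof.
split=> -[c m]; split; [exact: chain_image | by move=> k /chain_preim/m | exact: chain_preim |].
by move=> k /chain_image/m.
Qed.

End LengthMorphism.

(** * Ascending chain conditions *)

Definition acc_on (X : Type) (good : X -> Prop) (le : X -> X -> Prop) :=
  forall f : nat -> X, (forall m, good (f m)) -> (forall m, le (f m) (f m.+1)) ->
  exists m0, forall m, (m0 <= m)%N -> le (f m) (f m0).

(** A counterexample always has a strictly larger one, and dependent choice iterates this into a
    sequence that never stabilizes. Strictness is [~ le y x] because predicates are compared by
    inclusion, not equality. *)
Lemma acc_on_ind (X : Type) (good : X -> Prop) (le : X -> X -> Prop) (P : X -> Prop) :
  acc_on good le ->
  (forall x, good x -> (forall y, good y -> le x y -> ~ le y x -> P y) -> P x) ->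
  forall x, good x -> P x.
Proof.
move=> accX IH x gx; apply: contrapT => nPx.
pose Y := {z | good z /\ ~ P z}.
have step (z : Y) : exists z' : Y, le (sval z) (sval z') /\ ~ le (sval z') (sval z).
  case: z => z [gz nPz] /=; apply: contrapT => nz; apply: nPz; apply: IH => // y gy zy nyz.
  by apply: contrapT => nPy; apply: nz; exists (exist _ y (conj gy nPy)).
have [nxt nxtP] := choice step.
pose f m : Y := iter m nxt (exist _ x (conj gx nPx)).
have fg m : good (sval (f m)) by case: (f m) => z [].
have fl m : le (sval (f m)) (sval (f m.+1)) by case: (nxtP (f m)).
have [m0 Hm] := accX _ fg fl.
by case: (nxtP (f m0)) => _; apply; apply: (Hm m0.+1).
Qed.

Lemma seq_mono (X : Type) (le : X -> X -> Prop) (f : nat -> X) :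
  (forall x, le x x) -> (forall x y z, le x y -> le y z -> le x z) ->
  (forall m, le (f m) (f m.+1)) -> forall m n, (m <= n)%N -> le (f m) (f n).
Proof.
move=> refl trans fS m n /subnK<-; elim: (n - m)%N => // k IHk.
exact: trans IHk (fS _).
Qed.

Definition incl (T : Type) (P Q : T -> Prop) := forall x, P x -> Q x.

Lemma noetherian_acc (A : comRingType) : noetherian A -> acc_on (@ideal A) (@incl A).
Proof.
move=> noeA f fI fS.
have fM := seq_mono (le := @incl A) (fun P x h => h) (fun P Q R h k x l => k x (h x l)) fS.
have [|gs gsP] := noeA (fun x => exists m, f m x).
  split; first split.
  - by exists 0%N; apply: addsubgroup0; case: (fI 0%N).
  - move=> x y [m fx] [n fy]; exists (maxn m n); apply: addsubgroupB; first by case: (fI (maxn m n)).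
      by apply: fM fx; apply: leq_maxl.
    by apply: fM fy; apply: leq_maxr.
  by move=> a x [m fx]; exists m; case: (fI m) => _; apply.
have gf (i : nat) : exists m, f m gs`_i.
  have [isz|] := ltnP i (size gs); last first.
    by move/(nth_default 0)->; exists 0%N; apply: addsubgroup0; case: (fI 0%N).
  apply/gsP; exists (fun k => (k == i)%:R); rewrite (bigD1 (Ordinal isz)) //= eqxx mul1r.
  rewrite big1 ?addr0 // => k; rewrite -val_eqE /= => /negPf->; exact: mul0r.
have [h hP] := choice gf.
exists (\max_(i < size gs) h i)%N => m _ x fx.
have [sg fa] := fI (\max_(i < size gs) h i)%N.
have /gsP[r ->] : exists m, f m x by exists m.
apply: (addsubgroup_sum sg) => i _; apply: fa; apply: fM (hP i).
exact: (leq_bigmax i).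
Qed.

Section Families.
Variables (A : comRingType) (V : zmodType) (act : A -> V -> V).
Hypothesis actB : forall a, sub_morph (act a).
Hypothesis actBl : forall x, sub_morph (act^~ x).
Hypothesis actA : forall a b x, act a (act b x) = act (a * b) x.
Local Notation submod := (submod_act act).

(* A graded submodule is given by its homogeneous components. *)
Definition family := int -> V -> Prop.
Implicit Types (L lo hi D : family) (T : V -> V) (Ts : seq (V -> V)).

Definition leF L L' := forall n x, L n x -> L' n x.

Definition linear_op T := sub_morph T /\ forall a x, T (act a x) = act a (T x).

(* Every operator is of degree one. *)
Definition stable Ts L := (forall n, submod (L n)) /\
  forall T, List.In T Ts -> forall n x, L n x -> L (n + 1) (T x).

Lemma stable_addsubgroup Ts L n : stable Ts L -> addsubgroup (L n).
Proof. by case=> /(_ n)[]. Qed.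

Lemma stable_act Ts L n a x : stable Ts L -> L n x -> L n (act a x).
Proof. by case=> /(_ n)[_ + _]; apply. Qed.

Definition between lo hi Ts L := [/\ stable Ts L, leF lo L & leF L hi].

Definition accF lo hi Ts := acc_on (between lo hi Ts) leF.

Lemma leF_refl L : leF L L. Proof. by []. Qed.

Lemma leF_trans L L' L'' : leF L L' -> leF L' L'' -> leF L L''.
Proof. by move=> h k n x /h/k. Qed.

Lemma leF_seq (f : nat -> family) : (forall m, leF (f m) (f m.+1)) ->
  forall m n, (m <= n)%N -> leF (f m) (f n).
Proof. by apply: (seq_mono leF_refl) => x y z; apply: leF_trans. Qed.

Lemma accF_sub lo hi lo' hi' Ts Ts' : leF lo lo' -> leF hi' hi ->
  (forall L, between lo' hi' Ts' L -> stable Ts L) -> accF lo hi Ts -> accF lo' hi' Ts'.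
Proof.
move=> ll hh st acc f fb; apply: acc => m; have := fb m; case=> _ l h.
by split; [apply: (st _ (fb m)) | apply: leF_trans l | apply: leF_trans hh].
Qed.

Lemma stableI Ts L L' : stable Ts L -> stable Ts L' -> stable Ts (fun n x => L n x /\ L' n x).
Proof.
move=> [sL tL] [sL' tL']; split=> [n|T TTs n x [Lx L'x]]; first exact: submodI.
by split; [apply: tL | apply: tL'].
Qed.

Lemma stable_sum Ts L L' : (forall T, List.In T Ts -> linear_op T) ->
  stable Ts L -> stable Ts L' -> stable Ts (fun n => sum_pred (L n) (L' n)).
Proof.
move=> lin [sL tL] [sL' tL']; split=> [n|T TTs n _ [x [y [Lx L'y ->]]]]; first exact: submod_sum_pred.
have [TB _] := lin T TTs; rewrite (sub_morphD TB).
by exists (T x), (T y); split; [apply: tL | apply: tL' |].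
Qed.

(** Once the trace on [mid] and the sum with [mid] are both stationary, so is the family itself, by
    the modular law. *)
Lemma accF_trans lo mid hi Ts : (forall T, List.In T Ts -> linear_op T) ->
  stable Ts mid -> stable Ts hi ->
  leF lo mid -> leF mid hi -> accF lo mid Ts -> accF mid hi Ts -> accF lo hi Ts.
Proof.
move=> lin smid shi lm mh acc1 acc2 f fb fS.
have [m1 H1] : exists m1, forall m, (m1 <= m)%N ->
    leF (fun n x => f m n x /\ mid n x) (fun n x => f m1 n x /\ mid n x).
  apply: acc1 => m; last by move=> n x [fx mx]; split=> //; apply: fS.
  have [st l h] := fb m; split=> [|n x lx|n x []//]; first exact: stableI.
  by split; [apply: l | apply: lm].
have [m2 H2] : exists m2, forall m, (m2 <= m)%N ->
    leF (fun n => sum_pred (mid n) (f m n)) (fun n => sum_pred (mid n) (f m2 n)).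
  apply: acc2 => m; last by move=> n _ [x [y [mx /fS fy ->]]]; exists x, y.
  have [st l h] := fb m; split; first exact: stable_sum.
    by move=> n x mx; apply: sum_predl => //; case: st => /(_ n)[].
  move=> n _ [x [y [mx fy ->]]]; apply: addsubgroupD; first by case: shi => /(_ n)[].
    exact: mh.
  exact: h.
exists (maxn m1 m2) => m lem n x fx.
have fM := leF_seq fS.
have [[sf _] _ _] := fb m; have [sgf _] := sf n.
have [[sf' _] _ _] := fb (maxn m1 m2); have [sgf' _] := sf' n.
have sgm : addsubgroup (mid n) by case: smid => /(_ n)[].
have m1m : (m1 <= m)%N by apply: leq_trans lem; apply: leq_maxl.
have m2m : (m2 <= m)%N by apply: leq_trans lem; apply: leq_maxr.
have [u [v [mu fv ex]]] := H2 m m2m n x (sum_predr sgm fx).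
have fv' := fM _ _ (leq_maxr m1 m2) _ _ fv.
rewrite ex; apply: addsubgroupD => //.
have eu : u = x - v by rewrite ex addrK.
apply: (fM m1 _ (leq_maxl m1 m2)); apply: (H1 m m1m n u _).1; split=> //.
by rewrite eu; apply: addsubgroupB => //; apply: (fM _ _ m2m).
Qed.

(** * Hilbert's basis theorem for families *)

Section AddGenerator.
Variables (D : family) (h : int * V).

Definition add_gen : family :=
  fun n v => exists l a, D n l /\ v = l + (if n == h.1 then act a h.2 else 0).

Hypothesis sD : stable [::] D.

Lemma add_gen_le : leF D add_gen.
Proof.
by move=> n x Dx; exists x, 0; rewrite (sub_morph0 (actBl h.2)); case: ifP => _; rewrite addr0.
Qed.

Lemma add_gen_gen : act 1 h.2 = h.2 -> add_gen h.1 h.2.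
Proof.
move=> a1; exists 0, 1; rewrite eqxx a1 add0r; split=> //.
by case: sD => /(_ h.1)[[]].
Qed.

Lemma add_gen_stable : stable [::] add_gen.
Proof.
split=> // n; have [sg aD] := sD.1 n; split; first split.
- by apply: add_gen_le; apply: addsubgroup0.
- move=> _ _ [l [a [Dl ->]]] [l' [a' [Dl' ->]]]; exists (l - l'), (a - a').
  split; first exact: addsubgroupB.
  by rewrite opprD addrACA; case: ifP => _; rewrite ?subr0 // actBl.
move=> b _ [l [a [Dl ->]]]; exists (act b l), (b * a); split; first exact: aD.
rewrite (sub_morphD (actB b)); case: ifP => _; first by rewrite actA.
by rewrite (sub_morph0 (actB b)).
Qed.

(** Modulo [D] the new part is cyclic over [A] and sits in one degree, so a family in between is
    determined by the ideal of those [a] with [act a h.2] in it. *)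
Lemma add_gen_acc : noetherian A -> accF D add_gen [::].
Proof.
move=> noeA f fb fS.
have [m0 H] : exists m0, forall m, (m0 <= m)%N ->
    incl (fun a => f m h.1 (act a h.2)) (fun a => f m0 h.1 (act a h.2)).
  apply: (noetherian_acc noeA) => m; last by move=> a /fS.
  have [[sf _] _ _] := fb m; have [[f0 fB] fa] := sf h.1; split; first split.
  - by rewrite (sub_morph0 (actBl h.2)).
  - by move=> x y fx fy; rewrite actBl; apply: fB.
  by move=> a x fx; rewrite -actA; apply: fa.
exists m0 => m lem n x fx.
have [[sf _] lo1 hi1] := fb m; have [sg _] := sf n.
have [[sf' _] lo2 _] := fb m0; have [sg' _] := sf' n.
have [l [a [Dl ex]]] := hi1 _ _ fx; rewrite ex; apply: addsubgroupD => //; first exact: lo2.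
have : f m n (x - l) by apply: addsubgroupB => //; apply: lo1.
rewrite ex addrAC subrr add0r; case: eqVneq => [->|_ _]; last exact: addsubgroup0.
exact: H.
Qed.

End AddGenerator.

Section AddOperator.
Variables (Ts : seq (V -> V)) (T : V -> V) (lo D : family).
Hypothesis linTs : forall T', List.In T' Ts -> linear_op T'.
Hypothesis linT : linear_op T.
Hypothesis commT : forall T', List.In T' Ts -> forall x, T (T' x) = T' (T x).
Hypothesis slo : stable (T :: Ts) lo.
Hypothesis sD : stable Ts D.
Hypothesis loD : leF lo D.

(** Polynomials in [T] of degree less than [k] with coefficients in [D]; the coefficient of the
    [j]-th power sits in degree [n - j] because [T] has degree one. Such expressions are not unique,
    so a leading coefficient is not a function of the element. *)
Definition op_below (k : nat) : family :=
  fun n v => exists c : nat -> V,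
    (forall j, D (n - j%:Z) (c j)) /\ v = \sum_(j < k) iter j T (c j).

Definition add_op : family := fun n v => exists k, op_below k n v.

Lemma iterB k : sub_morph (iter k T).
Proof. by elim: k => // k IHk x y; rewrite !iterS IHk linT.1. Qed.

Lemma iter_act k a x : iter k T (act a x) = act a (iter k T x).
Proof. by elim: k => //= k ->; rewrite linT.2. Qed.

Lemma iter_comm k T' x : List.In T' Ts -> iter k T (T' x) = T' (iter k T x).
Proof. by move=> TTs; elim: k => //= k ->; rewrite commT. Qed.

Let sgD n : addsubgroup (D n). Proof. by case: sD => /(_ n)[]. Qed.

Lemma op_below_stable k : stable Ts (op_below k).
Proof.
split=> [n|T' TTs n _ [c [cD ->]]].
  split; first split.
  - exists (fun=> 0); split=> [j|]; first exact: addsubgroup0.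
    by rewrite big1 // => j _; rewrite (sub_morph0 (iterB j)).
  - move=> _ _ [c [cD ->]] [c' [cD' ->]]; exists (fun j => c j - c' j); split=> [j|].
      exact: addsubgroupB.
    by rewrite -sumrB; apply: eq_bigr => j _; rewrite iterB.
  move=> a _ [c [cD ->]]; exists (fun j => act a (c j)); split=> [j|].
    exact: (stable_act _ sD).
  by rewrite (sub_morph_sum (actB a)); apply: eq_bigr => j _; rewrite iter_act.
have [T'B _] := linTs TTs.
exists (fun j => T' (c j)); split=> [j|].
  by rewrite addrAC; apply: sD.2.
by rewrite (sub_morph_sum T'B); apply: eq_bigr => j _; rewrite iter_comm.
Qed.

Let sgH k n : addsubgroup (op_below k n). Proof. by case: (op_below_stable k) => /(_ n)[]. Qed.

Lemma op_belowS k n v : op_below k n v -> op_below k.+1 n v.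
Proof.
case=> c [cD ->]; exists (fun j => if (j < k)%N then c j else 0); split=> [j|].
  by case: ifP => // _; apply: addsubgroup0.
rewrite big_ord_recr /= ltnn (sub_morph0 (iterB k)) addr0.
by apply: eq_bigr => j _; rewrite ltn_ord.
Qed.

Lemma op_below_leq k k' n v : (k <= k')%N -> op_below k n v -> op_below k' n v.
Proof. by move=> /subnK<-; elim: (k' - k)%N => // i IHi /IHi/op_belowS. Qed.

Lemma op_below_op k n v : op_below k n v -> op_below k.+1 (n + 1) (T v).
Proof.
case=> c [cD ->]; exists (fun j => if j is j'.+1 then c j' else 0); split=> [[|j]|].
- exact: addsubgroup0.
- by rewrite (_ : n + 1 - j.+1%:Z = n - j%:Z) //; lia.
by rewrite big_ord_recl /= add0r (sub_morph_sum linT.1).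
Qed.

Lemma op_below_top k n d : D n d -> op_below k.+1 (n + k%:Z) (iter k T d).
Proof.
move=> Dd; exists (fun j => if j == k then d else 0); split=> [j|].
  by case: eqVneq => [->|_]; [rewrite addrK | apply: addsubgroup0].
rewrite big_ord_recr /= eqxx big1 ?add0r // => j _.
by rewrite ltn_eqF // (sub_morph0 (iterB j)).
Qed.

Lemma op_below_lead k n v : op_below k.+1 n v ->
  exists2 d, D (n - k%:Z) d & op_below k n (v - iter k T d).
Proof.
case=> c [cD ->]; exists (c k) => //; exists c; split=> //.
by rewrite big_ord_recr /= addrK.
Qed.

Lemma add_op_stable : stable (T :: Ts) add_op.
Proof.
split=> [n|T' [<-|TTs] n x [k Hx]].
- split; first split.
  + by exists 0%N; apply: addsubgroup0.
  + move=> x y [k Hx] [k' Hy]; exists (maxn k k'); apply: addsubgroupB => //.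
      by apply: op_below_leq Hx; apply: leq_maxl.
    by apply: op_below_leq Hy; apply: leq_maxr.
  by move=> a x [k Hx]; exists k; apply: (stable_act _ (op_below_stable k)).
- by exists k.+1; apply: op_below_op.
by exists k; apply: (op_below_stable k).2.
Qed.

Lemma add_op_le : leF D add_op.
Proof. by move=> n x Dx; exists 1%N; have := @op_below_top 0 n x Dx; rewrite addr0. Qed.

(* The family of leading coefficients of the elements of [L] of degree [k] in [T]. *)
Definition lead_family L (k : nat) : family :=
  fun n d => D n d /\ exists2 u, L (n + k%:Z) u & op_below k (n + k%:Z) (iter k T d - u).

Lemma lead_family_between L k : stable (T :: Ts) L -> leF lo L -> between lo D Ts (lead_family L k).
Proof.
move=> [sL tL] loL.
have loT n x i : lo n x -> lo (n + i%:Z) (iter i T x).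
  move=> lx; elim: i => [|i IHi]; first by rewrite addr0.
  by rewrite -addn1 PoszD addrA addn1 iterS; apply: (slo.2 T) => //; left.
split; [split=> [n|T' TTs n d [Dd [u Lu Hu]]] | | by move=> n d []].
- have [sgL aL] := sL (n + k%:Z); split; first split.
  + split; first exact: addsubgroup0.
    exists 0; rewrite ?(sub_morph0 (iterB k)) ?subrr; exact: addsubgroup0.
  + move=> d d' [Dd [u Lu Hu]] [Dd' [u' Lu' Hu']]; split; first exact: addsubgroupB.
    exists (u - u'); first exact: addsubgroupB.
    have -> : iter k T (d - d') - (u - u') = (iter k T d - u) - (iter k T d' - u').
      by rewrite iterB !opprD !opprK addrACA.
    exact: addsubgroupB.
  move=> a d [Dd [u Lu Hu]]; split; first exact: (stable_act _ sD).
  exists (act a u); first exact: aL.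
  by rewrite iter_act -actB; apply: (stable_act _ (op_below_stable k)).
- split; first exact: sD.2.
  rewrite addrAC; exists (T' u); first by apply: tL => //; right.
  have [T'B _] := linTs TTs.
  by rewrite iter_comm // -T'B; apply: (op_below_stable k).2.
move=> n x lx; split; first exact: loD.
exists (iter k T x); first by apply: loL; apply: loT.
by rewrite subrr; apply: addsubgroup0.
Qed.

Lemma lead_familyS L k : stable (T :: Ts) L -> leF (lead_family L k) (lead_family L k.+1).
Proof.
move=> [sL tL] n d [Dd [u Lu Hu]]; split=> //.
rewrite -addn1 PoszD addrA addn1 iterS; exists (T u); first by apply: tL => //; left.
by rewrite -linT.1; apply: op_below_op.
Qed.

Lemma lead_family_le L L' k : leF L L' -> leF (lead_family L k) (lead_family L' k).
Proof. by move=> LL n d [Dd [u Lu Hu]]; split=> //; exists u => //; apply: LL. Qed.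

(** The leading families grow with both [m] and [k]. The diagonal is stationary from [d0] on, which
    settles all [k >= d0]; the finitely many [k] below [d0] are settled one by one. *)
Lemma add_op_acc : accF lo D Ts -> accF lo add_op (T :: Ts).
Proof.
move=> acc f fb fS.
have fM := leF_seq fS.
have st m : stable (T :: Ts) (f m) by case: (fb m).
have bt m k : between lo D Ts (lead_family (f m) k) by apply: lead_family_between => //; case: (fb m).
have kM m := leF_seq (fun k => @lead_familyS (f m) k (st m)).
have [d0 Hd] : exists m0, forall m, (m0 <= m)%N -> leF (lead_family (f m) m) (lead_family (f m0) m0).
  apply: (acc (fun m => lead_family (f m) m)) => // m.
  by apply: leF_trans (@lead_family_le _ _ m (fS m)) _; apply: lead_familyS.
have ex k : exists g, forall m, (g <= m)%N -> leF (lead_family (f m) k) (lead_family (f g) k).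
  by apply: (acc (fun m => lead_family (f m) k)) => // m; apply: lead_family_le.
have [g Hg] := choice ex.
pose m1 := maxn d0 (\max_(k < d0) g k).
have gm1 k : (k < d0)%N -> (g k <= m1)%N.
  move=> kd; apply: leq_trans (leq_maxr _ _); exact: (leq_bigmax (Ordinal kd)).
have main m k : (m1 <= m)%N -> leF (lead_family (f m) k) (lead_family (f m1) k).
  move=> lem; have [kd|dk] := ltnP k d0.
    apply: leF_trans (Hg k m (leq_trans (gm1 k kd) lem)) _.
    by apply: lead_family_le; apply: fM; apply: gm1.
  have d0m1 : (d0 <= m1)%N by apply: leq_maxl.
  apply: (@leF_trans _ (lead_family (f (maxn m k)) (maxn m k))).
    apply: leF_trans (kM m _ _ (leq_maxr m k)) _.
    by apply: lead_family_le; apply: fM; apply: leq_maxl.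
  apply: leF_trans (Hd _ _) _; first by rewrite leq_max dk orbT.
  apply: (leF_trans (kM _ _ _ dk)); apply: lead_family_le; exact: fM.
exists m1 => m lem n x fx.
have [k Hx] : add_op n x by have [_ _] := fb m; apply.
(* Induction on the degree in [T]: an element [u] of [f m1] with the same leading term as [x], up to
   lower degree, is subtracted. *)
elim: k => [|k IHk] in x fx Hx *.
  case: Hx => c [_ ->]; rewrite big_ord0; apply: addsubgroup0.
  by case: (st m1) => /(_ n)[].
have [d Dd Hd'] := op_below_lead Hx.
have sgm : addsubgroup (f m n) by case: (st m) => /(_ n)[].
have sgm1 : addsubgroup (f m1 n) by case: (st m1) => /(_ n)[].
have [_ [u fu Hu]] : lead_family (f m1) k (n - k%:Z) d.
  apply: (main m k lem); split=> //; rewrite subrK; exists x => //.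
  by rewrite -opprB; apply: addsubgroupN.
rewrite subrK in fu Hu.
have fu' : f m n u by apply: fM fu.
apply: (addsubgroup_subK sgm1 _ fu); apply: IHk; first exact: addsubgroupB.
by rewrite -(subrKA (iter k T d)); apply: addsubgroupD.
Qed.

End AddOperator.

Definition generated lo (gs : seq (int * V)) Ts : family :=
  foldr add_op (foldr (fun h D => add_gen D h) lo gs) Ts.

(** The commuting list [Ts] stands for the variables: generators are adjoined over [A], then the
    operators one at a time, and each extension keeps the chain condition relative to [lo]. *)
Lemma hilbert_basis lo gs Ts : noetherian A -> (forall x, act 1 x = x) ->
  (forall T, List.In T Ts -> linear_op T) ->
  (forall T T', List.In T Ts -> List.In T' Ts -> forall x, T (T' x) = T' (T x)) ->
  stable Ts lo ->
  [/\ stable Ts (generated lo gs Ts), leF lo (generated lo gs Ts),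
      forall h, h \in gs -> generated lo gs Ts h.1 h.2 & accF lo (generated lo gs Ts) Ts].
Proof.
move=> noeA act1; elim: Ts => [|T Ts IHTs] lin comm slo; last first.
  have lin' T' : List.In T' Ts -> linear_op T' by move=> ?; apply: lin; right.
  have linT : linear_op T by apply: lin; left.
  have commT T' : List.In T' Ts -> forall x, T (T' x) = T' (T x).
    by move=> ?; apply: comm; [left | right].
  have slo' : stable Ts lo by split=> [n|T' ?]; [apply: slo.1 | apply: slo.2; right].
  have [|sG lG gG accG] := IHTs lin' _ slo'.
    by move=> T1 T2 ? ?; apply: comm; right.
  have le := add_op_le linT sG.
  split; [exact: add_op_stable | exact: leF_trans lG le | by move=> h /gG/le | exact: add_op_acc].
rewrite /generated /=; elim: gs => [|h gs [sG lG gG accG]] /=.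
  split=> //= f fb fS; exists 0%N => m _ n x fx.
  by have [_ _ H] := fb m; have [_ H' _] := fb 0%N; apply/H'/H.
have le := @add_gen_le (foldr (fun h D => add_gen D h) lo gs) h.
split; first exact: add_gen_stable.
- exact: leF_trans lG le.
- move=> h'; rewrite inE => /predU1P[->|/gG/le//]; exact: add_gen_gen.
apply: accF_trans lG le accG _ => //; first exact: add_gen_stable.
exact: add_gen_acc.
Qed.

End Families.

(** * Finiteness of associated primes *)

Section AssociatedPrimes.
Variables (A : comRingType) (V : zmodType) (act : A -> V -> V).
Hypothesis actB : forall a, sub_morph (act a).
Hypothesis actBl : forall x, sub_morph (act^~ x).
Hypothesis actA : forall a b x, act a (act b x) = act (a * b) x.
Hypothesis act1 : forall x, act 1 x = x.

Lemma annihilator_ideal (L : V -> Prop) x : submod_act act L -> ideal (fun a => L (act a x)).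
Proof.
move=> [[L0 LB] La]; split; first split.
- by rewrite (sub_morph0 (actBl x)).
- by move=> a b la lb; rewrite actBl; apply: LB.
by move=> a b lb; rewrite -actA; apply: La.
Qed.

(* If [p] is a maximal annihilator modulo [L], every element killed by [p] and outside [L]
   has annihilator [p]; one then goes on modulo the family of these elements. *)
Lemma ass_family_finite (Ts : seq (V -> V)) (lo hi : family V) : noetherian A ->
  (forall T, List.In T Ts -> linear_op act T) ->
  stable act Ts lo -> stable act Ts hi -> leF lo hi -> accF act lo hi Ts ->
  exists ps : seq (A -> Prop), forall n x p, hi n x -> prime_ideal p ->
    (forall a, p a <-> lo n (act a x)) -> exists2 q, List.In q ps & forall a, p a <-> q a.
Proof.
move=> noeA lin slo shi lohi accLH.
pose concl (L : family V) := exists ps : seq (A -> Prop), forall n x p, hi n x -> prime_ideal p ->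
    (forall a, p a <-> L n (act a x)) -> exists2 q, List.In q ps & forall a, p a <-> q a.
apply: (acc_on_ind accLH (P := concl)) => [L [sL loL Lhi] IH|]; last by split.
case: (EM (exists n w, hi n w /\ ~ L n w)) => [[n0 [w0 [hw0 nLw0]]]|all]; last first.
  exists [::] => n x p hx [_ [np1 _]] pE; case: np1; apply/pE; rewrite act1.
  by apply: contrapT => nL; apply: all; exists n, x.
pose ann n w a := L n (act a w).
pose isann (I : A -> Prop) := ideal I /\ exists n w, [/\ hi n w, ~ L n w & forall a, I a <-> ann n w a].
have [p [[_ [n1 [w1 [hw1 nLw1 pE]]]] pmax]] :
    exists p, isann p /\ forall q, isann q -> incl p q -> incl q p.
  have : exists p, isann p.
    exists (ann n0 w0); split; first exact: annihilator_ideal (sL.1 n0).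
    by exists n0, w0.
  case=> p0 [Ip0 ann0]; move: ann0.
  apply: (acc_on_ind (noetherian_acc noeA) (P := fun I =>
      (exists n w, [/\ hi n w, ~ L n w & forall a, I a <-> ann n w a]) ->
      exists p, isann p /\ forall q, isann q -> incl p q -> incl q p)) Ip0.
  move=> I idI IHI annI; case: (EM (exists q, [/\ isann q, incl I q & ~ incl q I])).
    by case=> q [[idq annq] Iq nqI]; apply: IHI annq.
  move=> nex; exists I; split=> // q annq Iq; apply: contrapT => nqI.
  by apply: nex; exists q.
pose Lp : family V := fun n v => hi n v /\ forall a, p a -> L n (act a v).
have LLp : leF L Lp by move=> n x Lx; split; [apply: Lhi | move=> a _; apply: (stable_act _ sL)].
have sLp : stable act Ts Lp.
  split=> [n|T TTs n x [hx Lx]].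
    have [sgh ah] := shi.1 n; have [sgL aL] := sL.1 n; split; first split.
    - split; first exact: addsubgroup0.
      by move=> a _; rewrite (sub_morph0 (actB a)); apply: addsubgroup0.
    - move=> x y [hx Lx] [hy Ly]; split; first exact: addsubgroupB.
      by move=> a pa; rewrite actB; apply: addsubgroupB; auto.
    move=> b x [hx Lx]; split; first exact: ah.
    by move=> a pa; rewrite actA mulrC -actA; apply: aL; apply: Lx.
  split; first exact: shi.2.
  by move=> a pa; rewrite -(lin T TTs).2; apply: sL.2 => //; apply: Lx.
have [|||ps psP] := IH Lp.
- by split=> //; [apply: leF_trans LLp | move=> n x []].
- by [].
- move=> LpL; apply: nLw1; apply: LpL; split=> // a pa; exact/pE.
exists (p :: ps) => n x q hx pq qE.
(* If [act a x] lies in [Lp] with [a] outside [q], its annihilator is still [q] and contains [p], so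
   it is [p] by maximality. Otherwise [q] is also the annihilator of [x] modulo [Lp]. *)
case: (EM (exists a, ~ q a /\ Lp n (act a x))) => [[a [nqa [hax Lpax]]]|none].
  have annq b : q b <-> ann n (act a x) b.
    rewrite /ann actA -qE; case: pq => -[_ qi] [_ qp]; split=> [qb|/qp[]//].
    by rewrite mulrC; apply: qi.
  have nL : ~ L n (act a x) by rewrite -qE.
  exists p; first by left.
  have pq' : incl p q by move=> b /Lpax ?; apply/annq.
  have : isann q by split; [case: pq | exists n, (act a x)].
  by move=> /pmax /(_ pq') qp b; split=> [/qp|/pq'].
have [b|q' qps qq'] := psP n x q hx pq; last by exists q' => //; right.
split=> [/qE/LLp //|lp]; apply: contrapT => nqb; apply: none; by exists b.
Qed.

End AssociatedPrimes.

(** * Hilbert polynomials *)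

Definition telescopes (f : rat -> rat) := exists Q : {poly rat}, forall x, Q.[x + 1] - Q.[x] = f x.

Lemma telescopes_ext f g : f =1 g -> telescopes f -> telescopes g.
Proof. by move=> e [Q QE]; exists Q => x; rewrite -e QE. Qed.

Lemma telescopesD f g : telescopes f -> telescopes g -> telescopes (fun x => f x + g x).
Proof. by case=> P PE [Q QE]; exists (P + Q) => x; rewrite -PE -QE !hornerD opprD addrACA. Qed.

Lemma telescopesZ c f : telescopes f -> telescopes (fun x => c * f x).
Proof. by case=> P PE; exists (c *: P) => x; rewrite -PE !hornerZ mulrBr. Qed.

Lemma telescopes_sum k (F : 'I_k -> rat -> rat) :
  (forall i, telescopes (F i)) -> telescopes (fun x => \sum_(i < k) F i x).
Proof.
elim: k F => [|k IHk] F HF.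
  by exists 0 => x; rewrite big_ord0 !horner0 subrr.
apply: (@telescopes_ext (fun x => \sum_(i < k) F (widen_ord (leqnSn k) i) x + F ord_max x)).
  by move=> x; rewrite big_ord_recr.
by apply: telescopesD => //; apply: IHk.
Qed.

(** The difference of [x ^+ k.+1] is [k.+1 * x ^+ k] plus lower powers, which telescope by
    induction. *)
Lemma telescopesXn k : telescopes (fun x => x ^+ k).
Proof.
elim/ltn_ind: k => k IHk.
have [Q QE] : telescopes (fun x => \sum_(i < k) ('C(k.+1, i))%:R * x ^+ i).
  by apply: telescopes_sum => i; apply: telescopesZ; apply: IHk.
have k0 : (k.+1)%:R != 0 :> rat by rewrite pnatr_eq0.
exists ((k.+1)%:R^-1 *: ('X^(k.+1) - Q)) => x; rewrite !hornerE -mulrBr.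
have -> : (x + 1) ^+ k.+1 - Q.[x + 1] - (x ^+ k.+1 - Q.[x]) =
  (x + 1) ^+ k.+1 - x ^+ k.+1 - (Q.[x + 1] - Q.[x]) by ring.
rewrite QE exprD1n big_ord_recr big_ord_recr /= binn binSn.
rewrite (eq_bigr (fun i : 'I_k => ('C(k.+1, i))%:R * x ^+ i)) => [|i _]; last by rewrite mulr_natl.
rewrite mulr1n -[x ^+ k *+ k.+1]mulr_natl.
set s := \sum_(i < k) _.
by rewrite (_ : _ - s = k.+1%:R * x ^+ k) ?mulKf //; ring.
Qed.

Lemma telescopes_poly (P : {poly rat}) : telescopes (fun x => P.[x]).
Proof.
apply: (@telescopes_ext (fun x => \sum_(i < size P) P`_i * x ^+ i)).
  by move=> x; rewrite horner_coef.
by apply: telescopes_sum => i; apply/telescopesZ/telescopesXn.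
Qed.

Section HilbertPolynomial.
Variables (A : comRingType) (V : zmodType) (act : A -> V -> V).
Hypothesis actB : forall a, sub_morph (act a).

(* Induction on the operators: the kernel and the cokernel of [T] on [hi / lo] are families
   killed by [T], and the difference of their lengths is the first difference of the length. *)
Lemma hilbert_polynomial (Ts : seq (V -> V)) (lo hi : family V) :
  (forall T, List.In T Ts -> linear_op act T) ->
  (forall T T', List.In T Ts -> List.In T' Ts -> forall x, T (T' x) = T' (T x)) ->
  stable act Ts lo -> stable act Ts hi -> leF lo hi -> accF act lo hi Ts ->
  (forall n, exists l, quot_length act (lo n) (hi n) l) ->
  exists (P : {poly rat}) (n0 : int), forall n : int, n0 <= n ->
    exists l, quot_length act (lo n) (hi n) l /\ P.[n%:~R] = l%:R.
Proof.
elim: Ts lo hi => [|T Ts IHTs] lo hi lin comm slo shi lohi acc fin.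
  (* Without operators, [hi] up to degree [m] and [lo] above it form a stable family that ascends
     with [m]; the chain condition then forces [hi = lo] in large degrees. *)
  have [m0 H] : exists m0, forall m, (m0 <= m)%N ->
      leF (fun n x => if n <= m%:Z then hi n x else lo n x)
          (fun n x => if n <= m0%:Z then hi n x else lo n x).
    apply: acc => m; last first.
      move=> n x; case: (lerP n m%:Z) => [le hx|_ lx]; first by rewrite ifT //; lia.
      by case: ifP => _ //; apply: lohi.
    split; first (split=> // n).
    - by case: (n <= m%:Z); [apply: shi.1 | apply: slo.1].
    - by move=> n x lx; case: ifP => // _; apply: lohi.
    by move=> n x; case: ifP => // _; apply: lohi.
  exists 0, (m0%:Z + 1) => n le; exists 0%N; split; last by rewrite horner0.
  apply: quot_length_refl; [exact: slo.1 | exact: lohi | move=> x hx].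
  have m0n : (m0 <= `|n|)%N by lia.
  have := H _ m0n n x; have -> : (n <= m0%:Z) = false by lia.
  have -> : n <= `|n|%N%:Z by lia.
  by apply.
have lin' T' : List.In T' Ts -> linear_op act T' by move=> ?; apply: lin; right.
have comm' T1 T2 : List.In T1 Ts -> List.In T2 Ts -> forall x, T1 (T2 x) = T2 (T1 x).
  by move=> ? ?; apply: comm; right.
have [TB Ta] : linear_op act T by apply: lin; left.
have commT T' : List.In T' Ts -> forall x, T (T' x) = T' (T x).
  by move=> ?; apply: comm; [left | right].
have sub L : stable act (T :: Ts) L -> stable act Ts L.
  by move=> [s t]; split=> // T' ?; apply: t; right.
have loT n x : lo n x -> lo (n + 1) (T x) by apply: slo.2; left.
have hiT n x : hi n x -> hi (n + 1) (T x) by apply: shi.2; left.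
pose K : family V := fun n x => hi n x /\ lo (n + 1) (T x).
pose C : family V := fun n => sum_pred (lo n) (fun y => exists2 x, hi (n - 1) x & y = T x).
have sK : stable act Ts K.
  split=> [n|T' TTs n x [hx lx]].
    have [sgh ah] := shi.1 n; have [sgl al] := slo.1 (n + 1); split; first split.
    - by split; [| rewrite (sub_morph0 TB)]; apply: addsubgroup0.
    - by move=> x y [hx lx] [hy ly]; rewrite /K TB; split; apply: addsubgroupB.
    by move=> a x [hx lx]; rewrite /K Ta; split; [apply: ah | apply: al].
  split; first by apply: shi.2 => //; right.
  by rewrite commT //; apply: slo.2 => //; right.
have sTh : stable act Ts (fun n y => exists2 x, hi (n - 1) x & y = T x).
  split=> [n|T' TTs n _ [x hx ->]].
    have [sgh ah] := shi.1 (n - 1); split; first split.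
    - by exists 0; [apply: addsubgroup0 | rewrite (sub_morph0 TB)].
    - by move=> _ _ [x hx ->] [y hy ->]; exists (x - y); [apply: addsubgroupB | rewrite TB].
    by move=> a _ [x hx ->]; exists (act a x); [apply: ah | rewrite Ta].
  exists (T' x); last by rewrite commT.
  by rewrite addrAC; apply: shi.2 => //; right.
have sC : stable act Ts C by apply: stable_sum => //; apply: sub.
have loK : leF lo K by move=> n x lx; split; [apply: lohi | apply: loT].
have Khi : leF K hi by move=> n x [].
have loC : leF lo C.
  by move=> n x lx; apply: sum_predl => //; exact: (stable_addsubgroup _ sTh).
have Chi : leF C hi.
  move=> n _ [x [_ [lx [y hy ->] ->]]]; apply: addsubgroupD; first exact: (stable_addsubgroup _ shi).
    exact: lohi.
  by rewrite -[n](subrK 1); apply: hiT.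
have TC n x : hi n x -> C (n + 1) (T x).
  move=> hx; apply: sum_predr; first exact: (stable_addsubgroup _ slo).
  by exists x; rewrite ?addrK.
have fin_split (L : family V) : stable act Ts L -> leF lo L -> leF L hi -> forall n,
    exists a b, [/\ quot_length act (lo n) (L n) a, quot_length act (L n) (hi n) b &
      forall l, quot_length act (lo n) (hi n) l -> l = (a + b)%N].
  move=> sL lL Lh n; have [l ql] := fin n.
  have [a [b [qa qb _]]] := quot_length_split actB (slo.1 n) (sL.1 n) (shi.1 n) (lL n) (Lh n) ql.
  exists a, b; split=> // l' ql'; apply: quot_length_unique ql' _.
  apply: quot_length_add (lL n) (Lh n) qa qb => //; [exact: slo.1 | exact: sL.1 | exact: shi.1].
have [PK [nK HK]] : exists (P : {poly rat}) (n0 : int), forall n : int, n0 <= n ->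
    exists l, quot_length act (lo n) (K n) l /\ P.[n%:~R] = l%:R.
  apply: IHTs => //; [exact: sub | |
    by move=> n; have [a [b [qa _ _]]] := fin_split K sK loK Khi n; exists a].
  (* [T] sends [K] into [lo], so every family in between is stable under [T] as well. *)
  apply: accF_sub acc => //.
  move=> L [[sL tL] lL LK]; split=> // T' [<-|]; last exact: tL.
  by move=> n x /LK[_ lx]; apply: lL.
have [PC [nC HC]] : exists (P : {poly rat}) (n0 : int), forall n : int, n0 <= n ->
    exists l, quot_length act (C n) (hi n) l /\ P.[n%:~R] = l%:R.
  apply: IHTs => //; [exact: sub | |
    by move=> n; have [a [b [_ qb _]]] := fin_split C sC loC Chi n; exists b].
  apply: accF_sub acc => //.
  move=> L [[sL tL] CL Lh]; split=> // T' [<-|]; last exact: tL.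
  by move=> n x /Lh hx; apply/CL/TC.
(* The first difference of the length is the length of [hi / C] in degree [n + 1] minus that of
   [K / lo] in degree [n]; [Q] is its discrete antiderivative. *)
have [Q QE] := telescopes_poly (PC \Po ('X + 1) - PK).
have [f fE] := choice fin.
have step (n : int) : nK <= n -> nC <= n ->
    (f (n + 1))%:R - (f n)%:R = Q.[n%:~R + 1] - Q.[n%:~R] :> rat.
  move=> leK leC; rewrite QE !hornerE horner_comp !hornerE.
  have [k [qk ek]] := HK n leK.
  have [|c [qc ec]] := HC (n + 1); first by lia.
  have [a [c' [qa qc' eC]]] := fin_split C sC loC Chi (n + 1).
  have [k' [b [qk' qb eK]]] := fin_split K sK loK Khi n.
  (* [T] induces an isomorphism from [hi / K] in degree [n] onto [C / lo] in degree [n + 1], so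
     these two lengths cancel. *)
  have qa' : quot_length act (lo (n + 1)) (C (n + 1)) b.
    suff H : quot_length act (K n) (hi n) b <-> quot_length act (lo (n + 1)) (C (n + 1)) b by apply/H.
    apply: (quot_length_iso TB Ta actB) => //.
    - exact: shi.1.
    - by move=> y [u [_ [lu [x hx ->] ->]]]; exists x; rewrite ?addrK in hx *.
    - exact: TC.
    - exact: slo.1.
    - exact: sC.1.
    exact: loC.
  rewrite (eC _ (fE _)) (eK _ (fE _)).
  rewrite (quot_length_unique qc' qc) (quot_length_unique qa qa') (quot_length_unique qk' qk).
  move: ek ec; rewrite intrD !natrD; lra.
exists (Q + ((f (Num.max nK nC))%:R - Q.[(Num.max nK nC)%:~R])%:P), (Num.max nK nC) => n le.
exists (f n); split=> //; rewrite hornerD hornerC.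
have -> : n = Num.max nK nC + `|n - Num.max nK nC|%N%:Z by lia.
elim: `|_|%N => [|m IHm]; first by rewrite addr0; ring.
set x := Num.max nK nC + m%:Z in IHm.
have -> : Num.max nK nC + m.+1%:Z = x + 1 by rewrite /x; lia.
have := step x ltac:(rewrite /x; lia) ltac:(rewrite /x; lia); move: IHm; rewrite intrD; lra.
Qed.

End HilbertPolynomial.

(** * Homogeneous components *)

Lemma big_uniq_widen (I : eqType) (V : zmodType) (s t : seq I) (c : I -> V) :
  uniq s -> uniq t -> {subset s <= t} -> (forall i, i \notin s -> c i = 0) ->
  \sum_(i <- t) c i = \sum_(i <- s) c i.
Proof.
move=> us ut st c0; rewrite (bigID (mem s)) /= [X in _ + X]big1 ?addr0; last by move=> i /c0.
rewrite -big_filter; apply: perm_big; apply: uniq_perm => //; first exact: filter_uniq.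
by move=> i; rewrite mem_filter andb_idr // => /st.
Qed.

Section Components.
Variables (I : eqType) (V : zmodType) (G : I -> V -> Prop).
Hypothesis sgG : forall i, addsubgroup (G i).

Record projections (pr : I -> V -> V) : Prop := Projections {
  proj_in : forall i v, G i (pr i v);
  projB : forall i, sub_morph (pr i);
  proj_id : forall i v, G i v -> pr i v = v;
  proj_ne : forall i k v, i != k -> G i v -> pr k v = 0;
  proj_sum : forall v, exists s : seq I, uniq s /\ v = \sum_(i <- s) pr i v
}.

Definition decomposition v (s : seq I) (c : I -> V) :=
  [/\ uniq s, forall i, G i (c i), forall i, i \notin s -> c i = 0 & v = \sum_(i <- s) c i].

Hypothesis ddG : direct_decomp G.

Lemma decomposition_exists v : exists s c, decomposition v s c.
Proof.
(* The index list may contain repetitions, so each component is taken with its multiplicity in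
   [s]. *)
have [s [c [Gc ->]]] := ddG.1 v; exists (undup s), (fun i => c i *+ count_mem i s); split.
- exact: undup_uniq.
- move=> i; elim: (count_mem i s) => [|k IHk]; first exact: addsubgroup0.
  by rewrite mulrS; apply: addsubgroupD.
- by move=> i; rewrite mem_undup => /count_memPn->.
by rewrite -(big_undup_iterop_count _ s).
Qed.

Lemma decomposition_unique v s c s' c' : decomposition v s c -> decomposition v s' c' -> c =1 c'.
Proof.
move=> [us Gc c0 vE] [us' Gc' c0' vE'] i.
pose t := undup (s ++ s').
have ut : uniq t by apply: undup_uniq.
have st : {subset s <= t} by move=> k ks; rewrite mem_undup mem_cat ks.
have st' : {subset s' <= t} by move=> k ks; rewrite mem_undup mem_cat ks orbT.
have [it|] := boolP (i \in t); last first.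
  by rewrite mem_undup mem_cat negb_or => /andP[/c0-> /c0'->].
apply/eqP; rewrite -subr_eq0; apply/eqP.
apply: (ddG.2 t (fun k => c k - c' k)) it => //; first by move=> k; apply: addsubgroupB.
by rewrite sumrB (big_uniq_widen (c := c) us) // (big_uniq_widen (c := c') us') // -vE -vE' subrr.
Qed.

Lemma projections_exist : exists pr, projections pr.
Proof.
have [pr prP] := choice (fun v => let: ex_intro s (ex_intro c h) := decomposition_exists v in
  ex_intro (fun c => exists s, decomposition v s c) c (ex_intro _ s h)).
exists (fun i v => pr v i); split.
- by move=> i v; have [s []] := prP v.
- move=> i x y; have [s [us Gs s0 xE]] := prP x; have [s' [us' Gs' s0' yE]] := prP y.
  have [s'' d''] := prP (x - y).
  apply: (decomposition_unique d'' (s' := undup (s ++ s')) (c' := fun i => pr x i - pr y i)).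
  have ut : uniq (undup (s ++ s')) by apply: undup_uniq.
  split=> // [k|k|].
  + exact: addsubgroupB.
  + by rewrite mem_undup mem_cat negb_or => /andP[/s0-> /s0'->]; rewrite subrr.
  rewrite sumrB (big_uniq_widen (c := pr x) us) // => [|k ks]; last by rewrite mem_undup mem_cat ks.
  rewrite (big_uniq_widen (c := pr y) us') // => [|k ks]; last by rewrite mem_undup mem_cat ks orbT.
  by rewrite -xE -yE.
- move=> i v Gv; have [s d] := prP v.
  rewrite (decomposition_unique d (s' := [:: i]) (c' := fun k => if k == i then v else 0)) ?eqxx //.
  split=> // [k|k|]; last by rewrite big_seq1 eqxx.
    by case: eqVneq => [->|_] //; apply: addsubgroup0.
  by rewrite inE => /negPf->.
- move=> i k v ik Gv; have [s d] := prP v.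
  rewrite (decomposition_unique d (s' := [:: i]) (c' := fun k => if k == i then v else 0)) ?eqxx //.
    by rewrite eq_sym (negPf ik).
  split=> // [l|l|]; last by rewrite big_seq1 eqxx.
    by case: eqVneq => [->|_] //; apply: addsubgroup0.
  by rewrite inE => /negPf->.
by move=> v; have [s [us _ _ vE]] := prP v; exists s.
Qed.

End Components.

Section GradedModule.
Variables (S : comRingType) (Sg : nat -> S -> Prop) (N : lmodType S) (Ng : int -> N -> Prop).
Hypothesis gradN : graded_module Sg Ng.
Variable pr : int -> N -> N.
Hypothesis prP : projections Ng pr.

Lemma proj_scale (i : nat) n s v : Sg i s -> pr (i%:Z + n) (s *: v) = s *: pr n v.
Proof.
move=> Ss; have [t [ut vE]] := proj_sum prP v.
have NS k : Ng (i%:Z + k) (s *: pr k v) by apply: gradN.2.2 => //; apply: (proj_in prP).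
rewrite {1}vE scaler_sumr (sub_morph_sum (projB prP _)).
have [nt|nt] := boolP (n \in t).
  rewrite (bigD1_seq n) //= (proj_id prP (NS n)) big1 ?addr0 // => k kn.
  by apply: (proj_ne prP) (NS k) => //; rewrite (inj_eq (addrI _)).
rewrite big1_seq => [|k /andP[_ kt]].
  have {1}-> : pr n v = pr n (\sum_(k <- t) pr k v) by rewrite -vE.
  rewrite (sub_morph_sum (projB prP _)) big1_seq ?scaler0 // => k /andP[_ kt].
  by apply: (proj_ne prP) (proj_in prP k v) => //; apply: contraNneq nt => <-.
by apply: (proj_ne prP) (NS k) => //; rewrite (inj_eq (addrI _)); apply: contraNneq nt => <-.
Qed.

Lemma homogeneous_generators : fg_module N -> exists hs : seq (int * N),
  (forall h, h \in hs -> Ng h.1 h.2) /\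
  forall Q : N -> Prop, addsubgroup Q -> (forall s x, Q x -> Q (s *: x)) ->
    (forall h, h \in hs -> Q h.2) -> forall v, Q v.
Proof.
case=> gs gsP.
have [sup supP] := choice (proj_sum prP).
exists (flatten [seq [seq (n, pr n g) | n <- sup g] | g <- gs]); split.
  by move=> h /flatten_mapP[g _ /mapP[n _ ->]]; apply: (proj_in prP).
move=> Q sgQ Qs Qh v; have [r ->] := gsP v.
apply: addsubgroup_sum => // i _; apply: Qs.
have [_ ->] := supP gs`_i; rewrite big_seq; apply: addsubgroup_sum => // n ns.
apply: (Qh (n, pr n gs`_i)); apply/flatten_mapP; exists gs`_i; first exact: mem_nth.
by apply/mapP; exists n.
Qed.

Lemma graded_module_ind (prS : nat -> S -> S) (hs : seq (int * N)) (G : int -> N -> Prop) :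
  projections Sg prS -> (forall h, h \in hs -> Ng h.1 h.2) ->
  (forall Q : N -> Prop, addsubgroup Q -> (forall s x, Q x -> Q (s *: x)) ->
    (forall h, h \in hs -> Q h.2) -> forall v, Q v) ->
  (forall n, addsubgroup (G n)) ->
  (forall h, h \in hs -> forall (i : nat) s, Sg i s -> G (i%:Z + h.1) (s *: h.2)) ->
  forall n v, Ng n v -> G n v.
Proof.
move=> prSP hsN gen sgG GP n v Nv; rewrite -(proj_id prP Nv) -[v]scale1r.
(* Quantifying over all scalars and degrees makes the predicate closed under scaling; a scalar is
   split into components only when a generator is reached. *)
apply: (gen (fun v => forall s n, G n (pr n (s *: v)))).
- split=> [s k|x y Gx Gy s k]; first by rewrite scaler0 (sub_morph0 (projB prP k)); apply: addsubgroup0.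
  by rewrite scalerBr (projB prP); apply: addsubgroupB.
- by move=> s x Gx r k; rewrite scalerA.
move=> h hh s k; have [t [_ ->]] := proj_sum prSP s.
rewrite scaler_suml (sub_morph_sum (projB prP _)); apply: addsubgroup_sum => // i _.
have Ss := proj_in prSP i s; have := gradN.2.2 i h.1 _ _ Ss (hsN h hh).
case: (eqVneq (i%:Z + h.1) k) => [<-|ik] Nh; first by rewrite (proj_id prP Nh); apply: GP.
by rewrite (proj_ne prP ik Nh); apply: addsubgroup0.
Qed.

End GradedModule.

(** * Homogeneous elements of a standard graded ring *)

Inductive hom_span (S : comRingType) (S0 : S -> Prop) (xs : seq S) : nat -> S -> Prop :=
| hom_span_base a : S0 a -> hom_span S0 xs 0 a
| hom_span_0 k : hom_span S0 xs k 0
| hom_span_sub k x y : hom_span S0 xs k x -> hom_span S0 xs k y -> hom_span S0 xs k (x - y)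
| hom_span_mul k x y : x \in xs -> hom_span S0 xs k y -> hom_span S0 xs k.+1 (x * y).

Section StandardGraded.
Variables (S : comRingType) (Sg : nat -> S -> Prop) (xs : seq S).
Hypothesis gradS : graded_ring Sg.
Hypothesis xs1 : forall x, x \in xs -> Sg 1%N x.
Hypothesis genS : forall s, alg_gen (Sg 0%N) xs s.
Local Notation span := (hom_span (Sg 0%N) xs).

Lemma addsubgroup_hom_span k : addsubgroup (span k).
Proof. by split; [apply: hom_span_0 | apply: hom_span_sub]. Qed.

Lemma hom_span_graded k s : span k s -> Sg k s.
Proof.
case: gradS => sg [_ [_ mul]]; elim=> {k s} [//|k|k x y _ Sx _ Sy|k x y /xs1 Sx _ Sy].
- exact: addsubgroup0.
- exact: addsubgroupB.
by rewrite -add1n; apply: mul.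
Qed.

Lemma hom_spanM i k s t : span i s -> span k t -> span (i + k) (s * t).
Proof.
case: gradS => sg [_ [_ mul]].
elim=> {i s} [a Sa|i|i x y _ IHx _ IHy|i x y xX _ IHy] st.
- elim: st => {k t} [b Sb|k|k x y _ IHx _ IHy|k x y xX _ IHy].
  + by apply: hom_span_base; apply: (mul 0%N 0%N).
  + by rewrite mulr0; apply: hom_span_0.
  + by rewrite mulrBr; apply: hom_span_sub.
  by rewrite mulrCA; apply: hom_span_mul.
- by rewrite mul0r; apply: hom_span_0.
- by rewrite mulrBl; apply: hom_span_sub; auto.
by rewrite -mulrA; apply: hom_span_mul; auto.
Qed.

(** [alg_gen] does not record degrees, so the induction shows that every component of every element
    lies in the span of its degree; for products both factors are split into components. *)
Lemma graded_hom_span k s : Sg k s -> span k s.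
Proof.
move=> Ss; have [pr prP] := projections_exist gradS.1 gradS.2.1.
suff H t : forall i, span i (pr i t) by rewrite -(proj_id prP Ss).
have sg i := addsubgroup_hom_span i.
have hom i t' : span i t' -> forall l, span l (pr l t').
  move=> st l; have St := hom_span_graded st.
  case: (eqVneq i l) => [<-|il]; first by rewrite (proj_id prP St).
  by rewrite (proj_ne prP il St); apply: hom_span_0.
elim: (genS t) => {t} [a Sa|x xX|x y _ IHx _ IHy|x y _ IHx _ IHy] i.
- by apply: (hom 0%N); apply: hom_span_base.
- apply: (hom 1%N); rewrite -[x]mulr1; apply: hom_span_mul => //; apply: hom_span_base.
  by case: gradS => _ [_ []].
- by rewrite (projB prP); apply: hom_span_sub.
have [s1 [_ xE]] := proj_sum prP x; have [s2 [_ yE]] := proj_sum prP y.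
rewrite xE yE mulr_suml (sub_morph_sum (projB prP _)).
apply: addsubgroup_sum => // l _; rewrite mulr_sumr (sub_morph_sum (projB prP _)).
by apply: addsubgroup_sum => // l' _; apply: (hom (l + l')%N); apply: hom_spanM.
Qed.

End StandardGraded.

(** * Growth and dimension *)

Section Dimension.
Variables (A S : comRingType) (act : A -> S -> S).
Hypothesis actM : forall a s t, act a (s * t) = s * act a t.
Hypothesis actB : forall a, sub_morph (act a).
Hypothesis noeS : noetherian S.
Variables (J : nat -> S -> Prop) (Z : S -> Prop).
Hypothesis idJ : forall K, ideal (J K).
Hypothesis J0 : forall s, J 0%N s.
Hypothesis ZJ : forall K x s, Z x -> J K s -> J K.+1 (x * s).
Hypothesis Zlen : forall I : S -> Prop, ideal I -> ~ I 1 -> incl Z I ->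
  length_le act I (@full_pred S) 1.

(** [J K] stands for the [K]-th power of the ideal generated by [Z]: elements of [Z] move [J K] into
    [J K.+1], and a proper ideal containing [Z] has colength at most one. The base [K.+1] is
    positive, so the bound grows with [d]. *)
Definition growth_le (I : S -> Prop) (C d : nat) :=
  forall K, length_le act (sum_pred I (J K)) (@full_pred S) (C * K.+1 ^ d)%N.

Definition prime_chain (I : S -> Prop) (d : nat) := exists c : nat -> S -> Prop,
  [/\ forall i, (i <= d)%N -> prime_ideal (c i),
      forall i, (i < d)%N -> strict_incl (c i) (c i.+1) & incl I (c 0%N)].

Lemma ideal_submod I : ideal I -> submod_act act I.
Proof.
move=> [sg m]; split=> // a x Ix.
by rewrite -[x]mulr1 actM mulrC; apply: m.
Qed.

Lemma ideal_sum (I I' : S -> Prop) : ideal I -> ideal I' -> ideal (sum_pred I I').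
Proof.
move=> [sg m] [sg' m']; split; first exact: addsubgroup_sum_pred.
by move=> a _ [x [y [Ix Iy ->]]]; exists (a * x), (a * y); rewrite mulrDr; split; auto.
Qed.

Definition principal (a x : S) := exists r, x = r * a.

Lemma ideal_principal a : ideal (principal a).
Proof.
split; first split.
- by exists 0; rewrite mul0r.
- by move=> _ _ [r ->] [r' ->]; exists (r - r'); rewrite mulrBl.
by move=> b _ [r ->]; exists (b * r); rewrite mulrA.
Qed.

Let sIJ I K : ideal I -> submod_act act (sum_pred I (J K)).
Proof. by move=> idI; apply/ideal_submod/ideal_sum. Qed.

Lemma improper_length I K : ideal I -> I 1 -> length_le act (sum_pred I (J K)) (@full_pred S) 0.
Proof.
move=> idI I1; apply: length_le_refl => //; first exact: sIJ.
move=> x _; apply: sum_predl; first by case: (idJ K).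
by rewrite -[x]mulr1; case: idI => _; apply.
Qed.

(** Multiplication by [a] maps [S / (I' + J K')] onto the part of [S / (I + J K)] generated by [a];
    what remains is the quotient for [I + (a)]. *)
Lemma length_le_principal I I' a K K' b b' : ideal I -> ideal I' ->
  (forall s, I' s -> I (a * s)) -> (forall s, J K' s -> J K (a * s)) ->
  length_le act (sum_pred I' (J K')) (@full_pred S) b ->
  length_le act (sum_pred (sum_pred I (principal a)) (J K)) (@full_pred S) b' ->
  length_le act (sum_pred I (J K)) (@full_pred S) (b + b').
Proof.
move=> idI idI' aI aJ lb lb'.
have idIa := ideal_sum idI (ideal_principal a).
have [sgI _] := idI; have [sgJ _] := idJ K; have [sgP _] := ideal_principal a.
apply: (length_le_add actB) lb' => //; [exact: sIJ | exact: sIJ | | ].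
  by move=> _ [x [y [Ix Jy ->]]]; exists x, y; split=> //; apply: sum_predl.
apply: (length_le_image (f := fun s => a * s)) lb => //.
- by move=> x y; rewrite mulrBr.
- by move=> _ [x [y [/aI Ix /aJ Jy ->]]]; split=> //; exists (a * x), (a * y); rewrite mulrDr.
move=> _ [_ [z [[x [_ [Ix [r ->] ->]] Jz ->]]]]; exists r => //.
by exists x, z; split=> //; ring.
Qed.

Lemma growth_of_ideal I : ideal I -> ~ I 1 -> exists C d, growth_le I C d /\ prime_chain I d.
Proof.
move: I; apply: (acc_on_ind (noetherian_acc noeS)
  (P := fun I => ~ I 1 -> exists C d, growth_le I C d /\ prime_chain I d)) => I idI IH nI1.
have ext a (I' := sum_pred I (principal a)) : ~ I a ->
    I' 1 \/ exists C d, growth_le I' C d /\ prime_chain I' d.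
  move=> nIa; case: (EM (I' 1)) => [|nI'1]; [by left | right; apply: IH => //].
  - exact: ideal_sum (ideal_principal a).
  - by move=> x Ix; apply: sum_predl => //; case: (ideal_principal a).
  move=> I'I; apply: nIa; apply: I'I; apply: sum_predr; first by case: idI.
  by exists 1; rewrite mul1r.
have pchain_sub I' d : incl I I' -> prime_chain I' d -> prime_chain I d.
  by move=> II' [c [c1 c2 c3]]; exists c; split=> // x /II'/c3.
have II' a : incl I (sum_pred I (principal a)).
  by move=> x Ix; apply: sum_predl => //; case: (ideal_principal a).
(* If [I] is not prime, it is compared with the larger ideals [I : a] and [I + (a)]; the longer of
   their two chains also lies above [I]. *)
case: (EM (exists a b, [/\ I (a * b), ~ I a & ~ I b])) => [[a [b [Iab nIa nIb]]]|np].
  pose I2 s := I (a * s).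
  have [[sg0 sgB] mI] := idI.
  have id2 : ideal I2.
    split; first split; rewrite /I2.
    - by rewrite mulr0.
    - by move=> x y Ix Iy; rewrite mulrBr; apply: sgB.
    by move=> c x Ix; rewrite mulrCA; apply: mI.
  have II2 : incl I I2 by move=> x; apply: mI.
  have n21 : ~ I2 1 by rewrite /I2 mulr1.
  have [|C2 [d2 [g2 p2]]] := IH _ id2 II2 _ n21; first by move=> I2I; apply: nIb; apply: I2I.
  have aJ K s : J K s -> J K (a * s) by case: (idJ K) => _; apply.
  case: (ext a nIa) => [I11|[C1 [d1 [g1 p1]]]].
    exists C2, d2; split; last exact: pchain_sub p2.
    move=> K; rewrite -[X in length_le _ _ _ X]addn0.
    apply: (length_le_principal idI id2 (fun s h => h) (aJ K)); first exact: g2.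
    by apply: improper_length => //; apply: ideal_sum (ideal_principal a).
  exists (C2 + C1)%N, (maxn d1 d2); split.
    move=> K; rewrite mulnDl; apply: (length_le_principal idI id2 (fun s h => h) (aJ K)).
      by apply: length_le_leq (g2 K); rewrite leq_mul2l leq_pexp2l ?orbT // leq_maxr.
    by apply: length_le_leq (g1 K); rewrite leq_mul2l leq_pexp2l ?orbT // leq_maxl.
  rewrite /maxn; case: ltnP => _; [exact: pchain_sub p2 | exact: pchain_sub p1].
have pI : prime_ideal I.
  split=> //; split=> // a b Iab; apply: contrapT => nab; apply: np; exists a, b.
  by split=> // ?; apply: nab; [left | right].
have chain0 : prime_chain I 0 by exists (fun=> I); split.
case: (EM (incl Z I)) => [ZI|/existsNP[x /not_implyP[Zx nIx]]].
  exists 1%N, 0%N; split=> // K; rewrite expn0 muln1 => k ck; apply: (Zlen idI nI1 ZI).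
  by apply: chain_sub ck => // y Iy; apply: sum_predl => //; case: (idJ K).
have len0 : length_le act (sum_pred I (J 0%N)) (@full_pred S) 0.
  apply: length_le_refl => //; first exact: sIJ.
  by move=> y _; apply: sum_predr; [case: idI | apply: J0].
(* Multiplication by [x] raises the index of [J] by one, so the length at [K.+1] exceeds that at [K]
   by at most the length for [I + (x)]. *)
have step K b b' : length_le act (sum_pred I (J K)) (@full_pred S) b ->
    length_le act (sum_pred (sum_pred I (principal x)) (J K.+1)) (@full_pred S) b' ->
    length_le act (sum_pred I (J K.+1)) (@full_pred S) (b + b').
  apply: (length_le_principal idI idI) => [s|s]; last exact: ZJ.
  by case: idI => _; apply.
case: (ext x nIx) => [I11|[C1 [d1 [g1 [c [c1 c2 c3]]]]]].
  exists 0%N, 0%N; split=> // K; rewrite mul0n; elim: K => [//|K IHK].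
  rewrite -[0%N]addn0; apply: step => //.
  by apply: improper_length => //; apply: ideal_sum (ideal_principal x).
exists C1, d1.+1; split.
  elim=> [|K IHK]; first by apply: length_le_leq len0.
  apply: length_le_leq (step _ _ _ IHK (g1 K.+1)).
  (* After bounding [(K + 1) ^ d1] by [(K + 2) ^ d1], this is [(K + 1) (K + 2) ^ d1 + (K + 2) ^ d1 =
     (K + 2) ^ (d1 + 1)]. *)
  rewrite -mulnDr leq_mul2l; apply/orP; right.
  rewrite [(K.+2 ^ d1.+1)%N]expnS -{1}[K.+2 in X in (_ <= X)%N]addn1.
  rewrite mulnDl mul1n leq_add2r expnS leq_mul2l.
  by case: (d1) => [|e]; rewrite ?expn0 ?leq_exp2r ?leqnn ?leqnSn ?orbT.
exists (fun i => if i is i'.+1 then c i' else I); split=> // [[|i]//|[|i]]; [exact: c1| |exact: c2].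
move=> _; split; first by move=> y /II'/c3.
exists x; split=> //; apply: c3; apply: sum_predr; first by case: idI.
by exists 1; rewrite mul1r.
Qed.

End Dimension.

(** * The filtration of a module by degree in the second set of operators *)

Section Filtration.
Variables (A : comRingType) (N : zmodType) (act : A -> N -> N).
Hypothesis actB : forall a, sub_morph (act a).
Hypothesis actBl : forall x, sub_morph (act^~ x).
Hypothesis actA : forall a b x, act a (act b x) = act (a * b) x.
Hypothesis act1 : forall x, act 1 x = x.
Variables Xs Ys : seq (N -> N).
Hypothesis linX : forall T, List.In T Xs -> linear_op act T.
Hypothesis linY : forall T, List.In T Ys -> linear_op act T.
Hypothesis commXX : forall T T', List.In T Xs -> List.In T' Xs -> forall x, T (T' x) = T' (T x).
Hypothesis commXY : forall T T', List.In T Xs -> List.In T' Ys -> forall x, T (T' x) = T' (T x).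
Hypothesis commYY : forall T T', List.In T Ys -> List.In T' Ys -> forall x, T (T' x) = T' (T x).
Variables (M0 : family N) (gs : seq (int * N)).
Hypothesis sM0 : stable act Xs M0.

(* The second index counts the operators of [Ys]. *)
Inductive gen_span : int -> nat -> N -> Prop :=
| gen_span0 n i : gen_span n i 0
| gen_spanB n i x y : gen_span n i x -> gen_span n i y -> gen_span n i (x - y)
| gen_span_act n i a x : gen_span n i x -> gen_span n i (act a x)
| gen_span_gen h : h \in gs -> gen_span h.1 0 h.2
| gen_spanX T n i x : List.In T Xs -> gen_span n i x -> gen_span (n + 1) i (T x)
| gen_spanY T n i x : List.In T Ys -> gen_span n i x -> gen_span (n + 1) i.+1 (T x).

Definition filt n i v := exists (m : N) (e : nat -> N),
  [/\ M0 n m, forall i', gen_span n i' (e i') & v = m + \sum_(i' < i) e i'].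

Hypothesis YM0 : forall T n x, List.In T Ys -> M0 n x -> gen_span (n + 1) 0 (T x).

Lemma filt_submod n i : submod_act act (filt n i).
Proof.
have [[m0 mB] ma] := sM0.1 n; split; first split.
- exists 0, (fun=> 0); split=> // [i'|]; first exact: gen_span0.
  by rewrite big1 ?addr0.
- move=> _ _ [m [e [Mm Ee ->]]] [m' [e' [Mm' Ee' ->]]].
  exists (m - m'), (fun k => e k - e' k); split; [exact: mB | by move=> k; apply: gen_spanB |].
  by rewrite sumrB opprD addrACA.
move=> a _ [m [e [Mm Ee ->]]]; exists (act a m), (fun k => act a (e k)).
split; [exact: ma | by move=> k; apply: gen_span_act |].
by rewrite (sub_morphD (actB a)) (sub_morph_sum (actB a)).
Qed.

Let sgF n i : addsubgroup (filt n i). Proof. by case: (filt_submod n i). Qed.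

Lemma filt0 n v : filt n 0 v <-> M0 n v.
Proof.
split=> [[m [e [Mm _ ->]]]|Mv]; first by rewrite big_ord0 addr0.
by exists v, (fun=> 0); split=> // [i|]; [apply: gen_span0 | rewrite big_ord0 addr0].
Qed.

Lemma gen_span_filt n i v : gen_span n i v -> filt n i.+1 v.
Proof.
move=> Ev; exists 0, (fun k => if k == i then v else 0); split.
- exact: (stable_addsubgroup _ sM0).1.
- by move=> k; case: eqVneq => [->|_] //; apply: gen_span0.
rewrite add0r big_ord_recr /= eqxx big1 ?add0r // => k _.
by rewrite ltn_eqF.
Qed.

Lemma filtS n i v : filt n i v -> filt n i.+1 v.
Proof.
case=> m [e [Mm Ee ->]]; exists m, (fun k => if (k < i)%N then e k else 0); split=> // [k|].
  by case: ifP => // _; apply: gen_span0.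
rewrite big_ord_recr /= ltnn addr0; congr (_ + _).
by apply: eq_bigr => k _; rewrite ltn_ord.
Qed.

Lemma filt_leq n i k v : (i <= k)%N -> filt n i v -> filt n k v.
Proof. by move=> /subnK<-; elim: (k - i)%N => // l IHl /IHl/filtS. Qed.

Lemma filt_lead n i v : filt n i.+1 v -> exists2 e, gen_span n i e & filt n i (v - e).
Proof.
case=> m [e [Mm Ee ->]]; exists (e i) => //; exists m, e; split=> //.
by rewrite big_ord_recr /= addrA addrK.
Qed.

Lemma filtX T n i v : List.In T Xs -> filt n i v -> filt (n + 1) i (T v).
Proof.
move=> TX [m [e [Mm Ee ->]]]; have [TB _] := linX TX.
exists (T m), (fun k => T (e k)); split; [exact: sM0.2 | by move=> k; apply: gen_spanX |].
by rewrite (sub_morphD TB) (sub_morph_sum TB).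
Qed.

(** The summand in [M0] is the delicate one, as [M0] need not be stable under [Ys]: [YM0] places its
    image in the first step. *)
Lemma filtY T n i v : List.In T Ys -> filt n i v -> filt (n + 1) i.+1 (T v).
Proof.
move=> TY [m [e [Mm Ee ->]]]; have [TB _] := linY TY.
rewrite (sub_morphD TB) (sub_morph_sum TB); apply: addsubgroupD => //.
  by apply: filt_leq (gen_span_filt (YM0 TY Mm)).
exists 0, (fun k => if k is k'.+1 then T (e k') else 0); split.
- exact: (stable_addsubgroup _ sM0).1.
- by case=> [|k]; [apply: gen_span0 | apply: gen_spanY].
by rewrite big_ord_recl /= !add0r.
Qed.

(** [act c] commutes with all the operators, so as soon as it sends the generators into [M0] it
    lowers the filtration by one step. *)
Lemma filt_ann c n i v : (forall h, h \in gs -> M0 h.1 (act c h.2)) ->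
  filt n i.+1 v -> filt n i (act c v).
Proof.
move=> cG /filt_lead[e Ee Fve].
rewrite -(subrK e v) (sub_morphD (actB c)); apply: addsubgroupD => //.
  by apply: (filt_submod n i).2.
elim: Ee => {Fve e n i} [n i|n i x y _ IHx _ IHy|n i a x _ IHx|h hG|T n i x TX _ IHx|T n i x TY _ IHx].
- by rewrite (sub_morph0 (actB c)); apply: addsubgroup0.
- by rewrite actB; apply: addsubgroupB.
- by rewrite actA mulrC -actA; apply: (filt_submod n i).2.
- by apply/filt0; apply: cG.
- by rewrite -(linX TX).2; apply: filtX.
by rewrite -(linY TY).2; apply: filtY.
Qed.

(* The associated graded module [gr (N / M0)] is the quotient [gr_hi / gr_lo], realised
   inside the sequences of elements of [N]. *)
Definition gr_act (a : A) (f : nat -> N) : nat -> N := fun i => act a (f i).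
Definition gr_lo : family (nat -> N) := fun n f => forall i, filt n i (f i).
Definition gr_hi : family (nat -> N) := fun n f => forall i, filt n i.+1 (f i).
Definition gr_X (T : N -> N) (f : nat -> N) : nat -> N := fun i => T (f i).
Definition gr_Y (T : N -> N) (f : nat -> N) : nat -> N := fun i => if i is i'.+1 then T (f i') else 0.
Definition gr_ops := List.app (List.map gr_X Xs) (List.map gr_Y Ys).
Definition single (i : nat) (v : N) : nat -> N := fun k => if k == i then v else 0.

Lemma gr_opsP T : List.In T gr_ops ->
  (exists2 T', List.In T' Xs & T = gr_X T') \/ (exists2 T', List.In T' Ys & T = gr_Y T').
Proof.
by move/List.in_app_iff => [] /List.in_map_iff[T' [<- ?]]; [left | right]; exists T'.
Qed.

Lemma gr_ops_linear T : List.In T gr_ops -> linear_op gr_act T.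
Proof.
case/gr_opsP=> -[T' TI ->].
  have [TB Ta] := linX TI; split=> [f g|a f]; apply: funext => i; [exact: TB | exact: Ta].
have [TB Ta] := linY TI; split=> [f g|a f]; apply: funext => -[|i] //=.
- by symmetry; apply: (subrr 0).
- exact: TB.
- by rewrite /gr_act (sub_morph0 (actB a)).
exact: Ta.
Qed.

Lemma gr_ops_comm T T' : List.In T gr_ops -> List.In T' gr_ops -> forall f, T (T' f) = T' (T f).
Proof.
case/gr_opsP=> -[U UI ->]; case/gr_opsP=> -[U' UI' ->] f; apply: funext => i.
- exact: (commXX UI UI').
- case: i => [|i] //=; rewrite /gr_X /=; last exact: (commXY UI UI').
  by have [TB _] := linX UI; rewrite (sub_morph0 TB).
- case: i => [|i] //=; rewrite /gr_X /=; last by symmetry; apply: (commXY UI' UI).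
  by have [TB _] := linX UI'; rewrite (sub_morph0 TB).
case: i => [|[|i]] //=; last exact: (commYY UI UI').
by have [TB _] := linY UI; have [TB' _] := linY UI'; rewrite (sub_morph0 TB) (sub_morph0 TB').
Qed.

Let gr_submod (h : nat -> nat) n : submod_act gr_act (fun f => forall i, filt n (h i) (f i)).
Proof.
split; first split.
- by move=> i; apply: addsubgroup0.
- by move=> f g Hf Hg i; apply: (addsubgroupB (sgF n (h i))).
by move=> a f Hf i; apply: (filt_submod n (h i)).2.
Qed.

Lemma gr_lo_stable : stable gr_act gr_ops gr_lo.
Proof.
split=> [n|T /gr_opsP[] [T' TI ->] n f Hf i]; first exact: (gr_submod id).
  exact: filtX.
by case: i => [|i]; [apply: addsubgroup0 | apply: filtY].
Qed.

Lemma gr_hi_stable : stable gr_act gr_ops gr_hi.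
Proof.
split=> [n|T /gr_opsP[] [T' TI ->] n f Hf i]; first exact: (gr_submod succn).
  exact: filtX.
by case: i => [|i]; [apply: addsubgroup0 | apply: filtY].
Qed.

Lemma gr_lo_hi : leF gr_lo gr_hi. Proof. by move=> n f Hf i; apply: filtS. Qed.

Lemma gr_actB a : sub_morph (gr_act a).
Proof. by move=> f g; apply: funext => i; apply: actB. Qed.

Lemma gr_actBl f : sub_morph (gr_act^~ f).
Proof. by move=> a b; apply: funext => i; apply: actBl. Qed.

Lemma gr_actA a b f : gr_act a (gr_act b f) = gr_act (a * b) f.
Proof. by apply: funext => i; apply: actA. Qed.

Lemma gr_act1 f : gr_act 1 f = f.
Proof. by apply: funext => i; apply: act1. Qed.

Variables (top : family N) (b : int -> nat).
Hypothesis filt_top : forall n i v, filt n i v -> top n v.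
Hypothesis top_filt : forall n v, top n v -> filt n (b n) v.

(** The filtration is finite in each degree, so modulo [gr_lo] a sequence in [gr_hi] has no entries
    from index [b n] on. This is why arbitrary sequences can replace the direct sum. *)
Lemma filt_stationary n i k v : (b n <= i)%N -> filt n k v -> filt n i v.
Proof. by move=> bi /filt_top/top_filt; apply: filt_leq. Qed.

Hypothesis noeA : noetherian A.

Lemma gr_acc : accF gr_act gr_lo gr_hi gr_ops.
Proof.
pose gs' := [seq (h.1, single 0 h.2) | h <- gs].
have [sG lG gG accG] := @hilbert_basis _ _ gr_act gr_actB gr_actBl gr_actA gr_lo gs' gr_ops
  noeA gr_act1 gr_ops_linear gr_ops_comm gr_lo_stable.
apply: accF_sub accG => // [n f Hf|L [] //].
set gen := generated _ _ _ _ in sG lG gG *.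
have sg n' := stable_addsubgroup n' sG.
have Egen n' i v : gen_span n' i v -> gen n' (single i v).
  elim=> {n' i v} [n' i|n' i x y _ IHx _ IHy|n' i a x _ IHx|h hG|T n' i x TX _ IHx|T n' i x TY _ IHx].
  - have -> : single i 0 = 0 by apply: funext => k; rewrite /single; case: ifP.
    exact: addsubgroup0.
  - have -> : single i (x - y) = single i x - single i y.
      by apply: funext => k; rewrite /single /= ![in RHS]fctE; case: ifP; rewrite ?subr0.
    exact: addsubgroupB.
  - have -> : single i (act a x) = gr_act a (single i x).
      by apply: funext => k; rewrite /single /gr_act; case: ifP; rewrite ?(sub_morph0 (actB a)).
    exact: (stable_act _ sG).
  - by apply: (gG (h.1, single 0 h.2)); apply: (map_f (fun h : int * N => (h.1, single 0 h.2))).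
  - have -> : single i (T x) = gr_X T (single i x).
      by apply: funext => k; rewrite /single /gr_X; case: ifP; rewrite ?(sub_morph0 (linX TX).1).
    by apply: sG.2 => //; apply/List.in_app_iff; left; apply: List.in_map.
  have -> : single i.+1 (T x) = gr_Y T (single i x).
    apply: funext => -[|k]; rewrite /single /gr_Y //= eqSS.
    by case: ifP; rewrite ?(sub_morph0 (linY TY).1).
  by apply: sG.2 => //; apply/List.in_app_iff; right; apply: List.in_map.
have : forall i, (b n <= i)%N -> filt n i (f i) by move=> i bi; apply: filt_stationary (Hf i).
(* Entries are removed from the last one down: [f k] equals some spanning element [e] modulo
   [filt n k], and [single k e] lies in [gen]. *)
elim: (b n) f Hf => [|k IHk] f Hf Hk; first by apply: lG => i; apply: Hk.
have [e Ee Fe] := filt_lead (Hf k).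
rewrite -(subrK (single k e) f); apply: addsubgroupD => //; last exact: Egen.
have val i : (f - single k e) i = if i == k then f k - e else f i.
  by rewrite !fctE /single; case: eqVneq => [->|_]; rewrite ?subr0.
apply: IHk => i; rewrite val.
  by case: eqVneq => [->|_] //; apply: filtS.
by case: eqVneq => [->|ik ki] //; apply: Hk; rewrite ltn_neqAle eq_sym ik.
Qed.

(** Length is additive along the filtration. The [K k], whose entries are trivial from index [k] on,
    filter the graded side in parallel, and evaluation at [k] identifies the steps. *)
Lemma gr_length n l : quot_length act (M0 n) (top n) l -> quot_length gr_act (gr_lo n) (gr_hi n) l.
Proof.
move=> ql.
pose K k : (nat -> N) -> Prop := fun f => gr_hi n f /\ forall i, (k <= i)%N -> filt n i (f i).
have sK k : submod_act gr_act (K k).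
  have [[h0 hB] ha] := gr_hi_stable.1 n; split; first split.
  - by split=> // i _; apply: addsubgroup0.
  - move=> f g [Hf Kf] [Hg Kg]; split; first exact: hB.
    by move=> i ki; apply: (addsubgroupB (sgF n i)); auto.
  by move=> a f [Hf Kf]; split; [apply: ha | move=> i ki; apply: (filt_submod n i).2; auto].
have KS k f : K k f -> K k.+1 f by case=> ? Hk; split=> // i ki; apply: Hk; apply: ltnW.
have loK k f : gr_lo n f -> K k f by move=> Hf; split=> //; apply: gr_lo_hi.
have main k l' : quot_length act (M0 n) (filt n k) l' -> quot_length gr_act (gr_lo n) (K k) l'.
  elim: k l' => [|k IHk] l' ql'.
    have /(quot_length_unique ql')-> : quot_length act (M0 n) (filt n 0) 0.
      by apply: quot_length_refl; [exact: sM0.1 | move=> x ?; apply/filt0 | move=> x /filt0].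
    apply: quot_length_refl; [exact: gr_lo_stable.1 | exact: loK |].
    by move=> f [_ Hf] i; apply: Hf.
  have [|||||p [q [qp qq ->]]] := quot_length_split (mid := filt n k) actB _ _ _ _ _ ql'.
  - exact: sM0.1.
  - exact: filt_submod.
  - exact: filt_submod.
  - by move=> x Mx; apply: (@filt_leq _ 0) => //; apply/filt0.
  - exact: filtS.
  apply: (quot_length_add gr_actB (mid := K k)) (IHk _ qp) _ => //;
    [exact: gr_lo_stable.1 | exact: loK | exact: KS |].
  suff H : quot_length gr_act (K k) (K k.+1) q <->
    quot_length act (filt n k) (filt n k.+1) q by apply/H.
  apply: (quot_length_iso (f := fun f : nat -> N => f k)) => //.
  - by move=> f Kf; split; [apply: KS | apply: Kf.2].
  - move=> y Fy; exists (single k y); last by rewrite /single eqxx subrr; apply: addsubgroup0.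
    split=> [i|i ki]; rewrite /single.
      by case: eqVneq => [->|_] //; apply: addsubgroup0.
    by rewrite gtn_eqF //; apply: addsubgroup0.
  - move=> f [Hf Kf] Fk; split=> // i; rewrite leq_eqVlt => /predU1P[<- //|]; exact: Kf.
  - by move=> f [Hf _]; apply: Hf.
  - exact: filt_submod.
  - exact: filt_submod.
  exact: filtS.
apply: (@quot_length_ext _ _ gr_act (gr_lo n) (K (b n))) => //.
  split=> [[]//|Hf]; split=> // i bi; exact: filt_stationary (Hf i).
apply: main; apply: quot_length_ext ql => // v; split; [exact: top_filt | exact: filt_top].
Qed.

Lemma top_hilbert_polynomial : (forall n, exists l, quot_length act (M0 n) (top n) l) ->
  exists (P : {poly rat}) (n0 : int), forall n : int, n0 <= n ->
    exists l, quot_length act (M0 n) (top n) l /\ P.[n%:~R] = l%:R.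
Proof.
move=> fin.
have [|P [n0 H]] := hilbert_polynomial gr_actB gr_ops_linear gr_ops_comm gr_lo_stable gr_hi_stable
  gr_lo_hi gr_acc.
  by move=> n; have [l /gr_length ql] := fin n; exists l.
exists P, n0 => n /H[l [ql Pl]]; have [l' ql'] := fin n; exists l'; split=> //.
by rewrite (quot_length_unique (gr_length ql') ql).
Qed.

(** Descent on the filtration index of the witness [x]: if [act a x] with [a] outside [p] falls one
    step lower, it has the same annihilator and replaces [x]; if none does, the class of [x] in its
    step already has annihilator [p]. *)
Lemma top_ass_finite : exists ps : seq (A -> Prop), forall n x p, top n x -> prime_ideal p ->
  (forall a, p a <-> M0 n (act a x)) -> exists2 q, List.In q ps & forall a, p a <-> q a.
Proof.
have [ps psP] := ass_family_finite gr_actB gr_actBl gr_actA gr_act1 noeA gr_ops_linear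
  gr_lo_stable gr_hi_stable gr_lo_hi gr_acc.
exists ps => n x p /top_filt Fx pp; elim: (b n) x Fx => [|i IHi] x Fx pE.
  case: (pp) => _ [np1 _]; case: np1; apply/pE; rewrite act1; exact/filt0.
have [_ [_ prim]] := pp; have [[_ mulp] _] := pp.
case: (EM (exists a, ~ p a /\ filt n i (act a x))) => [[a [npa Fax]]|none].
  apply: (IHi _ Fax) => c; rewrite actA -pE; split=> [pc|/prim[]//].
  by rewrite mulrC; apply: mulp.
apply: (psP n (single i x)) => //.
  by move=> k; rewrite /single; case: eqVneq => [->|_] //; apply: addsubgroup0.
move=> a; split=> [pa k|lo].
  rewrite /gr_act /single; case: eqVneq => [->|_]; last first.
    by rewrite (sub_morph0 (actB a)); apply: addsubgroup0.
  by apply: (@filt_leq _ 0) => //; apply/filt0/pE.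
apply: contrapT => npa; apply: none; exists a; split=> //.
by have := lo i; rewrite /gr_act /single eqxx.
Qed.

End Filtration.

(** * Degree bounds *)

Lemma lead_coef_coef (p : {poly rat}) k : (size p <= k.+1)%N -> p`_k != 0 -> lead_coef p = p`_k.
Proof.
move=> sp pk; rewrite lead_coefE; suff -> : size p = k.+1 by [].
by apply/eqP; rewrite eqn_leq sp ltnNge; apply: contra pk => /(nth_default 0)->.
Qed.

(** If the degree [e] of [P] were at least [d], each of the [n] terms would be at least a constant
    times [n ^ e] for large [n], and the sum would outgrow [n ^ d]. *)
Lemma poly_growth (P : {poly rat}) (h : nat -> nat) (n0 d C a b : nat) :
  (forall n, (n0 <= n)%N -> P.[n%:R] = (h n)%:R) ->
  (forall n, (n0 <= n)%N -> (\sum_(k < n) h (n + k) <= C * (a * n + b) ^ d)%N) ->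
  (size P <= d)%N.
Proof.
move=> Ph sumh; rewrite leqNgt; apply/negP => dP.
pose e := (size P).-1.
have Pe : size P = e.+1 by rewrite /e prednK //; apply: leq_ltn_trans dP.
have de : (d <= e)%N by rewrite -ltnS -Pe.
have lcE : lead_coef P = P`_e by rewrite lead_coefE.
have lc0 : lead_coef P != 0 by rewrite lead_coef_eq0 -size_poly_eq0 Pe.
have large (x : rat) : exists n : nat, forall k : nat, (n <= k)%N -> x <= k%:R.
  exists (Num.bound `|x|) => k nk; apply: le_trans (ler_norm x) _.
  by apply: ltW; apply: lt_le_trans (archi_boundP (normr_ge0 x)) _; rewrite ler_nat.
have [x1 Hx1] := polyrcf.poly_pinfty_gt_lc (R := rat) (p := (lead_coef P)^-1 *: P)
  ltac:(by rewrite lead_coefZ mulVf).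
rewrite lead_coefZ mulVf // in Hx1; have [n1 Hn1] := large x1.
have lcp : 0 < lead_coef P.
  rewrite lt_def lc0 leNgt; apply/negP => lcn.
  have := Hx1 _ (Hn1 _ (leq_maxr n0 n1)); rewrite hornerZ Ph ?leq_maxl // => /(lt_le_trans ltr01).
  by apply/negP; rewrite -leNgt mulr_le0_ge0 ?invr_le0 ?ler0n // ltW.
(* Half the leading coefficient, so that [c * x ^+ e] stays below [P] for large [x]. *)
pose c := lead_coef P / 2.
have c0 : 0 < c by rewrite divr_gt0.
have [x2 Hx2] : exists x2, forall x, x2 <= x -> c * x ^+ e <= P.[x].
  have Qe : (P - c *: 'X^e)`_e = c by rewrite coefB coefZ coefXn eqxx mulr1 -lcE /c; lra.
  have lcQ : lead_coef (P - c *: 'X^e) = c.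
    have := @lead_coef_coef (P - c *: 'X^e) e; rewrite Qe gt_eqF // => -> //.
    rewrite (leq_trans (size_polyD _ _)) // geq_max Pe leqnn size_polyN.
    by rewrite (leq_trans (size_scale_leq _ _)) // size_polyXn.
  have [x2 Hx2] := polyrcf.poly_pinfty_gt_lc (p := P - c *: 'X^e) ltac:(by rewrite lcQ).
  exists x2 => x /Hx2; rewrite lcQ hornerD hornerN hornerZ hornerXn => /(lt_le_trans c0).
  by rewrite subr_gt0 => /ltW.
have [n2 Hn2] := large x2.
(* [W] has leading coefficient [c > 0]; its positivity at a large [n] contradicts the upper bound on
   the sum. *)
pose W : {poly rat} := c *: 'X^(d.+1) - C%:R *: (a%:R *: 'X + b%:R%:P) ^+ d.
have sL : (size ((a%:R *: 'X + b%:R%:P) ^+ d : {poly rat}) <= d.+1)%N.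
  apply: leq_trans (size_poly_exp_leq _ _) _; rewrite ltnS -[X in (_ <= X)%N]mul1n leq_mul2r.
  apply/orP; right; rewrite -subn1 leq_subLR.
  rewrite (leq_trans (size_polyD _ _)) // geq_max (leq_trans (size_scale_leq _ _)) ?size_polyX //.
  by rewrite (leq_trans (size_polyC_leq1 _)).
have Wd : W`_d.+1 = c.
  rewrite coefB !coefZ coefXn eqxx mulr1 [X in _ - _ * X]nth_default ?mulr0 ?subr0 //.
have lcW : lead_coef W = c.
  have := @lead_coef_coef W d.+1; rewrite Wd gt_eqF // => -> //.
  rewrite (leq_trans (size_polyD _ _)) // geq_max size_polyN !(leq_trans (size_scale_leq _ _)) //.
    exact: leqW.
  by rewrite size_polyXn.
have [x3 Hx3] := polyrcf.poly_pinfty_gt_lc (p := W) ltac:(by rewrite lcW).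
have [n3 Hn3] := large x3.
pose n := (n0 + n2 + n3 + 1)%N.
have n_gt0 : (0 < n)%N by rewrite /n addn1.
have := Hx3 _ (Hn3 n ltac:(rewrite /n; lia)); rewrite lcW => /(lt_le_trans c0).
rewrite /W hornerD hornerN !hornerZ hornerXn horner_exp hornerD hornerZ hornerX hornerC subr_gt0.
apply/negP; rewrite -leNgt.
have := sumh n ltac:(rewrite /n; lia).
rewrite -(ler_nat rat) natrM natrX natrD natrM natr_sum; apply: le_trans.
rewrite exprS mulrCA; apply: (@le_trans _ _ (\sum_(k < n) c * n%:R ^+ e)); last first.
  apply: ler_sum => k _; rewrite -Ph; last by rewrite /n; lia.
  apply: le_trans (Hx2 _ _); last by apply: Hn2; rewrite /n; lia.
  by rewrite ler_pM2l // lerXn2r ?nnegrE ?ler0n // ler_nat leq_addr.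
rewrite sumr_const card_ord -[X in _ <= X]mulr_natl ler_pM2l ?ltr0n // ler_pM2l //.
by rewrite ler_weXn2l // ler1n.
Qed.

Lemma In_mem (T : eqType) (s : seq T) x : List.In x s <-> x \in s.
Proof.
elim: s => //= y s IHs; rewrite inE; split=> [[->|/IHs->]|/predU1P[->|/IHs]]; rewrite ?eqxx ?orbT //.
  by left.
by right.
Qed.

(** * Powers of the maximal ideal acting on modules of finite length *)

(** Only multiples of products of [l] elements of [m], without sums: additive closure is supplied by
    the subgroups into which these products send elements. *)
Inductive ideal_pow (A : comRingType) (m : A -> Prop) : nat -> A -> Prop :=
| ideal_pow0 c : ideal_pow m 0 c
| ideal_powS l a c : m a -> ideal_pow m l c -> ideal_pow m l.+1 (a * c).

Section IdealPow.
Variables (A : comRingType) (m : A -> Prop).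

Lemma ideal_pow_mull l a c : ideal_pow m l c -> ideal_pow m l (a * c).
Proof.
move=> H; elim: H a => {l c} [c a|l b c mb _ IH a]; first exact: ideal_pow0.
by rewrite mulrCA; apply: ideal_powS.
Qed.

Lemma ideal_pow_add k l c : ideal_pow m (k + l) c ->
  exists c1 c2, [/\ ideal_pow m k c1, ideal_pow m l c2 & c = c1 * c2].
Proof.
elim: k c => [|k IHk] c.
  by exists 1, c; rewrite mul1r; split=> //; apply: ideal_pow0.
rewrite addSn => H; inversion H as [|k' a c' ma mc']; subst.
have [c1 [c2 [m1 m2 ->]]] := IHk _ mc'.
by exists (a * c1), c2; rewrite mulrA; split=> //; apply: ideal_powS.
Qed.

Lemma ideal_pow_leq k l c : (k <= l)%N -> ideal_pow m l c -> ideal_pow m k c.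
Proof.
move=> /subnK<- /ideal_pow_add[c1 [c2 [_ m2 ->]]]; exact: ideal_pow_mull.
Qed.

Hypotheses (idm : ideal m) (nm1 : ~ m 1).
Hypothesis maxm : forall I, ideal I -> ~ I 1 -> forall x, I x -> m x.

Lemma local_unit x : ~ m x -> exists y, y * x = 1.
Proof.
move=> nmx; apply: contrapT => nu; apply: nmx.
apply: (maxm (ideal_principal x)); last by exists 1; rewrite mul1r.
by case=> r e; apply: nu; exists r.
Qed.

Variables (V : zmodType) (act : A -> V -> V).
Hypothesis actB : forall a, sub_morph (act a).
Hypothesis actBl : forall x, sub_morph (act^~ x).
Hypothesis actA : forall a b x, act a (act b x) = act (a * b) x.
Hypothesis act1 : forall x, act 1 x = x.

Lemma submod_cyclic v : submod_act act (fun x => exists a, x = act a v).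
Proof.
split; first split.
- by exists 0; rewrite (sub_morph0 (actBl v)).
- by move=> _ _ [a ->] [b ->]; exists (a - b); rewrite actBl.
by move=> a _ [b ->]; exists (a * b); rewrite actA.
Qed.

(* If [act c v] is outside [lo], multiplying [v] by the factors of [c] one at a time gives a
   strictly decreasing chain: [v = r a v] modulo [lo] with [a] in [m] would put [v] into [lo]. *)
Lemma ideal_pow_chain (lo : V -> Prop) l c v : submod_act act lo -> ideal_pow m l c -> ~ lo (act c v) ->
  chain_of_length act lo (sum_pred lo (fun x => exists a, x = act a v)) l.+1.
Proof.
move=> slo mc; have [sglo alo] := slo.
have sC w := submod_sum_pred actB slo (submod_cyclic w).
have mem w : sum_pred lo (fun x => exists a, x = act a w) w.
  by apply: sum_predr => //; exists 1; rewrite act1.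
have sub w x : lo x -> sum_pred lo (fun x => exists a, x = act a w) x.
  by apply: sum_predl; case: (submod_cyclic w).
elim: mc v => {l c} [c|l a c ma _ IH] v nlo.
  apply: (chain_rcons slo (sC v)); last exact: chain0.
  split; first exact: sub.
  by exists v; split=> // lv; apply: nlo; apply: alo.
rewrite mulrC -actA in nlo; apply: chain_rcons (IH _ nlo); [exact: sC | exact: sC | split].
  move=> _ [x [_ [lx [b ->] ->]]]; exists x, (act (b * a) v); split=> //; last by rewrite actA.
  by exists (b * a).
exists v; split=> // -[x [_ [lx [b ->]]]]; rewrite actA => vE; apply: nlo.
have lv : lo (act (1 - b * a) v) by rewrite actBl act1 {1}vE addrK.
have [|u uE] := @local_unit (1 - b * a).
  move=> mu; apply: nm1; rewrite -(subrK (b * a) 1); case: idm => sg mul.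
  by apply: addsubgroupD => //; apply: mul.
by apply/alo/alo; rewrite -(act1 v) -uE -actA; apply: alo.
Qed.

Lemma ideal_pow_kills (lo hi : V -> Prop) l c v : submod_act act lo -> submod_act act hi ->
  (forall x, lo x -> hi x) -> length_le act lo hi l -> ideal_pow m l c -> hi v -> lo (act c v).
Proof.
move=> slo [sghi ahi] lohi len mc hv; apply: contrapT => nlo.
have /len : chain_of_length act lo hi l.+1; last by rewrite ltnn.
apply: chain_sub (ideal_pow_chain slo mc nlo) => // _ [x [_ [lx [a ->] ->]]].
by apply: addsubgroupD; auto.
Qed.

End IdealPow.

(** * The filtration of [N] relative to [M], and its associated primes *)

Section Main.
Variables (A R S : comRingType).
Variables (alpha : {rmorphism A -> R}) (iota : {rmorphism R -> S}).
Variables (Rg : nat -> R -> Prop) (Sg : nat -> S -> Prop).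
Variables (M : lmodType R) (N : lmodType S) (Mg : int -> M -> Prop) (Ng : int -> N -> Prop).
Variable (j : M -> N).
Hypothesis noeA : noetherian A.
Hypothesis gradR : graded_ring Rg.
Hypothesis gradS : graded_ring Sg.
Variables (xs : seq R) (ys : seq S).
Hypothesis xs1 : forall x, x \in xs -> Rg 1%N x.
Hypothesis ys1 : forall y, y \in ys -> Sg 1%N y.
Hypothesis genR : forall r, alg_gen (Rg 0%N) xs r.
Hypothesis genS : forall s, alg_gen (Sg 0%N) ys s.
Hypothesis R0 : forall r, Rg 0%N r <-> exists a, r = alpha a.
Hypothesis S0 : forall s, Sg 0%N s <-> exists a, s = iota (alpha a).
Hypothesis iotag : forall n r, Rg n r -> Sg n (iota r).
Hypotheses (gradM : graded_module Rg Mg) (gradN : graded_module Sg Ng).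
Hypothesis jB : sub_morph j.
Hypothesis jZ : forall r x, j (r *: x) = iota r *: j x.
Hypothesis jg : forall n x, Mg n x -> Ng n (j x).

Let act (a : A) (x : N) := iota (alpha a) *: x.
Let Mn (n : int) (x : N) := exists m, Mg n m /\ x = j m.
Let Xs := List.map (fun x (v : N) => iota x *: v) xs.
Let Ys := List.map (fun y (v : N) => y *: v) ys.

Let actB a : sub_morph (act a). Proof. by move=> x y; rewrite /act scalerBr. Qed.
Let actBl x : sub_morph (act^~ x). Proof. by move=> a b; rewrite /act !rmorphB scalerBl. Qed.
Let actA a b x : act a (act b x) = act (a * b) x. Proof. by rewrite /act !rmorphM scalerA. Qed.
Let act1 x : act 1 x = x. Proof. by rewrite /act !rmorph1 scale1r. Qed.

Let scale_linear s : linear_op act (fun v : N => s *: v).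
Proof. by split=> [x y|a x]; rewrite ?scalerBr // /act !scalerA mulrC. Qed.

Let XsP T : List.In T Xs -> exists2 x, x \in xs & T = (fun v => iota x *: v).
Proof. by move/List.in_map_iff=> [x [<- /In_mem]]; exists x. Qed.

Let YsP T : List.In T Ys -> exists2 y, y \in ys & T = (fun v => y *: v).
Proof. by move/List.in_map_iff=> [x [<- /In_mem]]; exists x. Qed.

Let linX T : List.In T Xs -> linear_op act T.
Proof. by case/XsP=> x _ ->; apply: scale_linear. Qed.

Let linY T : List.In T Ys -> linear_op act T.
Proof. by case/YsP=> x _ ->; apply: scale_linear. Qed.

Let scale_comm (s t : S) (v : N) : s *: (t *: v) = t *: (s *: v).
Proof. by rewrite !scalerA mulrC. Qed.

Let commXX T T' : List.In T Xs -> List.In T' Xs -> forall x, T (T' x) = T' (T x).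
Proof. by move=> /XsP[x _ ->] /XsP[y _ ->] v; apply: scale_comm. Qed.
Let commXY T T' : List.In T Xs -> List.In T' Ys -> forall x, T (T' x) = T' (T x).
Proof. by move=> /XsP[x _ ->] /YsP[y _ ->] v; apply: scale_comm. Qed.
Let commYY T T' : List.In T Ys -> List.In T' Ys -> forall x, T (T' x) = T' (T x).
Proof. by move=> /YsP[x _ ->] /YsP[y _ ->] v; apply: scale_comm. Qed.

Let S0a a : Sg 0%N (iota (alpha a)). Proof. by apply/S0; exists a. Qed.
Let R0a a : Rg 0%N (alpha a). Proof. by apply/R0; exists a. Qed.

Let sNg n : submod_act act (Ng n).
Proof.
split=> [|a x Nx]; first exact: gradN.1.
by have := gradN.2.2 0%N n _ _ (S0a a) Nx; rewrite add0r.
Qed.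

Let stM : stable act Xs Mn.
Proof.
split=> [n|T /XsP[x xx ->] n _ [m [Mm ->]]].
  have [M0 MB] := gradM.1 n; split; first split.
  - by exists 0; rewrite (sub_morph0 jB).
  - by move=> _ _ [x [Mx ->]] [y [My ->]]; exists (x - y); rewrite jB; split=> //; apply: MB.
  move=> a _ [x [Mx ->]]; exists (alpha a *: x); rewrite jZ; split=> //.
  by have := gradM.2.2 0%N n _ _ (R0a a) Mx; rewrite add0r.
exists (x *: m); rewrite jZ addrC; split=> //.
by apply: (gradM.2.2 1%N) => //; apply: xs1.
Qed.

Let MnNg n x : Mn n x -> Ng n x. Proof. by case=> m [/jg Nm ->]. Qed.

Variables (prN : int -> N -> N) (prM : int -> M -> M) (prS : nat -> S -> S) (prR : nat -> R -> R).
Hypotheses (prNP : projections Ng prN) (prMP : projections Mg prM).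
Hypotheses (prSP : projections Sg prS) (prRP : projections Rg prR).
Variables (hsN : seq (int * N)) (hsM : seq (int * M)).
Hypothesis hsNg : forall h, h \in hsN -> Ng h.1 h.2.
Hypothesis hsMg : forall h, h \in hsM -> Mg h.1 h.2.
Hypothesis hsN_gen : forall Q : N -> Prop, addsubgroup Q -> (forall s x, Q x -> Q (s *: x)) ->
    (forall h, h \in hsN -> Q h.2) -> forall v, Q v.
Hypothesis hsM_gen : forall Q : M -> Prop, addsubgroup Q -> (forall s x, Q x -> Q (s *: x)) ->
    (forall h, h \in hsM -> Q h.2) -> forall v, Q v.

(* The generators [y *: j h] put [S_1 M] into the first step of the filtration. *)
Let gs : seq (int * N) := hsN ++ [seq (h.1 + 1, y *: j h.2) | y <- ys, h <- hsM].
Let E := gen_span act Xs Ys gs.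
Let F := filt act Xs Ys Mn gs.

Let gsNg h : h \in gs -> Ng h.1 h.2.
Proof.
rewrite mem_cat => /orP[/hsNg//|/allpairsP[[y h'] /= [yy hh ->]]] /=.
by rewrite addrC; apply: (gradN.2.2 1%N); [apply: ys1 | apply/jg/hsMg].
Qed.

Let XE n i x v : x \in xs -> E n i v -> E (n + 1) i (iota x *: v).
Proof.
move=> xx; apply: (gen_spanX (T := fun v => iota x *: v)).
by apply/List.in_map_iff; exists x; split=> //; apply/In_mem.
Qed.

Let YE n i y v : y \in ys -> E n i v -> E (n + 1) i.+1 (y *: v).
Proof.
move=> yy; apply: (gen_spanY (T := fun v => y *: v)).
by apply/List.in_map_iff; exists y; split=> //; apply/In_mem.
Qed.

(** For homogeneous [s] in [R] and a generator [h] of [M], [y] times [j (s *: h)] is [iota s] times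
    the generator [y *: j h]: only operators of [Xs] are used, whence the index [0]. *)
Let YM T n x : List.In T Ys -> Mn n x -> E (n + 1) 0 (T x).
Proof.
case/YsP=> y yy -> [m [Mm ->]].
apply: (graded_module_ind gradM prMP prRP hsMg hsM_gen (G := fun n m => E (n + 1) 0 (y *: j m))) Mm.
  move=> k; split=> [|u v Eu Ev]; first by rewrite (sub_morph0 jB) scaler0; apply: gen_span0.
  by rewrite jB scalerBr; apply: gen_spanB.
move=> h hh i s Rs; have := graded_hom_span gradR xs1 genR Rs.
elim=> {i s Rs} [_ /R0[a ->]|i|i u v _ Eu _ Ev|i x' s xx _ Es].
- rewrite add0r jZ scale_comm; apply: gen_span_act.
  have hg : (h.1 + 1, y *: j h.2) \in gs.
    by rewrite mem_cat; apply/orP; right; apply/allpairsP; exists (y, h).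
  exact: (gen_span_gen act Xs Ys hg).
- by rewrite scale0r (sub_morph0 jB) scaler0; apply: gen_span0.
- by rewrite scalerBl jB scalerBr; apply: gen_spanB.
rewrite -scalerA jZ scale_comm (_ : i.+1%:Z + h.1 + 1 = (i%:Z + h.1 + 1) + 1); last by lia.
exact: XE.
Qed.

Let ENg n i v : E n i v -> Ng n v.
Proof.
elim=> {n i v} [n i|n i x y _ Nx _ Ny|n i a x _ Nx|h /gsNg //
  |T n i x /XsP[r rr ->] _ Nx|T n i x /YsP[y yy ->] _ Nx].
- by case: (sNg n) => [[]].
- by case: (sNg n) => sg _; apply: addsubgroupB.
- by case: (sNg n) => _; apply.
- by rewrite addrC; apply: (gradN.2.2 1%N) => //; apply/iotag/xs1.
by rewrite addrC; apply: (gradN.2.2 1%N) => //; apply: ys1.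
Qed.

Let FNg n i v : F n i v -> Ng n v.
Proof.
case=> m [e [Mm Ee ->]]; have [sg _] := sNg n; apply: addsubgroupD => //; first exact: MnNg.
by apply: addsubgroup_sum => // k _; apply: ENg (Ee k).
Qed.

(** Strictly larger than every [|h.1|]: an element [s *: h] of degree [n] uses [n - h.1 < n + c]
    operators of [Ys], so [b n = n + c] steps fill up [Ng n], and [Ng n] is zero when
    [n + c < 0]. *)
Let c := (\max_(h <- hsN) `|h.1|).+1%N.
Let b (n : int) : nat := if (0 <= n + c%:Z)%R then `|(n + c%:Z)%R|%N else 0.

Let sgF n i : addsubgroup (F n i). Proof. by case: (filt_submod actB Ys gs stM n i). Qed.

Let NgF' n v : Ng n v -> if 0 <= n + c%:Z then F n (b n) v else v = 0.
Proof.
apply: (graded_module_ind gradN prNP prSP hsNg hsN_gen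
  (G := fun n v => if 0 <= n + c%:Z then F n (b n) v else v = 0)).
  by move=> k; case: (0 <= k + c%:Z) => //; split=> // x y -> ->; rewrite subrr.
move=> h hh i s Ss.
have hc : (`|h.1| < c)%N.
  by rewrite ltnS; apply: (leq_bigmax_seq (F := fun h : int * N => `|h.1|%N) h hh).
have -> : 0 <= i%:Z + h.1 + c%:Z by lia.
apply: (@filt_leq _ _ _ Xs Ys Mn gs _ i.+1); first by rewrite /b; case: ifP; lia.
apply: gen_span_filt => //.
have := graded_hom_span gradS ys1 genS Ss.
elim=> {i s Ss} [_ /S0[a ->]|i|i u w _ Eu _ Ew|i x s xx _ Es].
- by rewrite add0r; apply: gen_span_act; apply: gen_span_gen; rewrite mem_cat hh.
- by rewrite scale0r; apply: gen_span0.
- by rewrite scalerBl; apply: gen_spanB.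
rewrite -scalerA (_ : i.+1%:Z + h.1 = (i%:Z + h.1) + 1); last by lia.
exact: YE.
Qed.

Let NgF n v : Ng n v -> F n (b n) v.
Proof. by move/NgF'; case: ifP => // _ ->; apply: addsubgroup0. Qed.

Let Ng_neg n v : n + c%:Z < 0 -> Ng n v -> v = 0.
Proof. by move=> lt /NgF'; rewrite leNgt lt. Qed.

Lemma ass_graded_finite : exists ps : seq (A -> Prop), forall n x p, Ng n x -> prime_ideal p ->
  (forall a, p a <-> Mn n (act a x)) -> exists2 q, List.In q ps & forall a, p a <-> q a.
Proof.
exact: (top_ass_finite actB actBl actA act1 linX linY commXX commXY commYY stM YM FNg NgF noeA).
Qed.

Let jproj n m : prN n (j m) = j (prM n m).
Proof.
have hom k m' : Mg k m' -> prN n (j m') = j (prM n m').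
  move=> Mm; case: (eqVneq k n) => [<-|kn].
    by rewrite (proj_id prMP Mm) (proj_id prNP (jg Mm)).
  by rewrite (proj_ne prMP kn Mm) (proj_ne prNP kn (jg Mm)) (sub_morph0 jB).
have [t [_ ->]] := proj_sum prMP m.
rewrite (sub_morph_sum jB) (sub_morph_sum (projB prNP n)).
rewrite (sub_morph_sum (projB prMP n)) (sub_morph_sum jB).
by apply: eq_bigr => k _; apply: hom (proj_in prMP k m).
Qed.

Let act_proj n a v : prN n (act a v) = act a (prN n v).
Proof. by have := proj_scale gradN prNP n v (S0a a); rewrite add0r. Qed.

(** If [p] is the annihilator of [x] modulo [M], some component of [x] has annihilator [p]:
    otherwise each is killed by an element outside [p], and the product of these kills [x] while
    lying outside the prime [p]. *)
Lemma ass_finite : exists ps : seq (A -> Prop), forall p, ass_quot act (fun x => exists m, x = j m) p ->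
  exists2 q, List.In q ps & forall a, p a <-> q a.
Proof.
have [ps psP] := ass_graded_finite; exists ps => p [pp [x pE]].
have [n pn] : exists n, forall a, p a <-> Mn n (act a (prN n x)).
  apply: contrapT => none.
  have pMn a n : p a -> Mn n (act a (prN n x)).
    move=> /pE[m am]; rewrite -act_proj am jproj; exists (prM n m); split=> //.
    exact: proj_in prMP n m.
  have ex n : exists a, ~ p a /\ Mn n (act a (prN n x)).
    apply: contrapT => nex; apply: none; exists n => a; split=> [|Ma]; first exact: pMn.
    by apply: contrapT => npa; apply: nex; exists a.
  have [f fP] := choice ex; have [t [_ xE]] := proj_sum prNP x.
  have [_ [np1 prim]] := pp.
  have : ~ p (\prod_(n <- t) f n).
    elim: t {xE} => [|n t IHt]; first by rewrite big_nil.
    by rewrite big_cons => /prim[|//]; case: (fP n).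
  apply; apply/pE; rewrite xE.
  have sgM : addsubgroup (fun x => exists m, x = j m).
    split; first by exists 0; rewrite (sub_morph0 jB).
    by move=> _ _ [u ->] [v ->]; exists (u - v); rewrite jB.
  have kill n : n \in t -> Mn n (act (\prod_(n <- t) f n) (prN n x)).
    by move=> nt; rewrite (big_rem n) //= mulrC -actA; apply: (stable_act _ stM); apply: (fP n).2.
  set g := \prod_(n <- t) f n in kill *.
  rewrite (sub_morph_sum (actB g)) big_seq; apply: (addsubgroup_sum sgM) => n /kill[k [_ e]].
  by exists k; exact: e.
by apply: (psP n (prN n x)) => //; apply: (proj_in prNP).
Qed.

(** * The degree bound over a local ring *)

Section LocalCase.
Hypothesis noeS : noetherian S.
Variable m : A -> Prop.
Hypotheses (idm : ideal m) (nm1 : ~ m 1).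
Hypothesis maxm : forall I, ideal I -> ~ I 1 -> forall x, I x -> m x.
Variable len : int -> nat.
Hypothesis lenP : forall n, quot_length act (Mn n) (Ng n) (len n).

(** A module of length [l] over a local ring is killed by products of [l] elements of [m], so this
    exponent serves all generators at once. *)
Let l0 := \max_(h <- gs) len h.1.

Let mpow_gs a h : ideal_pow m l0 a -> h \in gs -> Mn h.1 (act a h.2).
Proof.
move=> ma hg; apply: (ideal_pow_kills idm nm1 maxm actB actBl actA act1 (hi := Ng h.1) (l := len h.1)).
- exact: stM.1.
- exact: sNg.
- exact: MnNg.
- exact: (lenP h.1).2.
- apply: ideal_pow_leq ma; exact: (leq_bigmax_seq (F := fun h : int * N => len h.1) h hg).
exact: gsNg.
Qed.

Let mpow_filt a n i v : ideal_pow m (l0 * i) a -> F n i v -> Mn n (act a v).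
Proof.
elim: i a v => [|i IHi] a v.
  by move=> _ /filt0 Mv; apply: (stable_act _ stM).
rewrite mulnS => /ideal_pow_add[a1 [a2 [m1 m2 ->]]] Fv; rewrite mulrC -actA; apply: IHi => //.
apply: (filt_ann actB actA linX linY stM YM) => // h hg; exact: mpow_gs.
Qed.

(* [mN e n] is the component of degree [n] of [m ^ e N]. *)
Let mN e n v := forall Q, addsubgroup Q ->
  (forall a w, ideal_pow m e a -> Ng n w -> Q (act a w)) -> Q v.

Let sg_mN e n : addsubgroup (mN e n).
Proof.
split=> [Q [] //|x y Hx Hy Q sgQ HQ].
by apply: addsubgroupB => //; [apply: Hx | apply: Hy].
Qed.

Let mN0 n v : Ng n v -> mN 0 n v.
Proof. by move=> Nv Q _ HQ; rewrite -(act1 v); apply: HQ => //; apply: ideal_pow0. Qed.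

Let mN_act e n a v : m a -> mN e n v -> mN e.+1 n (act a v).
Proof.
move=> ma Hv Q sgQ HQ; apply: (Hv (fun u => Q (act a u))).
  split=> [|x y Qx Qy]; first by rewrite (sub_morph0 (actB a)); apply: addsubgroup0.
  by rewrite actB; apply: addsubgroupB.
by move=> a' w ma' Nw; rewrite actA; apply: HQ => //; apply: ideal_powS.
Qed.

Let mN_mul e n y v : y \in ys -> mN e n v -> mN e (n + 1) (y *: v).
Proof.
move=> yy Hv Q sgQ HQ; apply: (Hv (fun u => Q (y *: u))).
  split=> [|u w Qu Qw]; first by rewrite scaler0; apply: addsubgroup0.
  by rewrite scalerBr; apply: addsubgroupB.
move=> a w ma Nw; rewrite /act scale_comm; apply: HQ => //.
by rewrite addrC; apply: (gradN.2.2 1%N) => //; apply: ys1.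
Qed.

Let mN_leq e e' n v : (e' <= e)%N -> mN e n v -> mN e' n v.
Proof.
by move=> le Hv Q sgQ HQ; apply: Hv => // a w ma Nw; apply: HQ => //; apply: ideal_pow_leq ma.
Qed.

Let mN_Mn e n v : (l0 * b n <= e)%N -> mN e n v -> Mn n v.
Proof.
move=> le Hv; apply: Hv; first by case: (stM.1 n).
by move=> a w ma Nw; apply: (mpow_filt (i := b n)); [apply: ideal_pow_leq ma | apply: NgF].
Qed.

(* This is the ideal of all [s] with [s N] inside the [K]-th power of the maximal homogeneous
   ideal times [N], as seen in each degree. *)
Let J K s := forall v n, mN (K - b n) n (prN n (s *: v)).

Let idJ K : ideal (J K).
Proof.
split; first split.
- by move=> v n; rewrite scale0r (sub_morph0 (projB prNP n)); apply: (addsubgroup0 (sg_mN _ _)).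
- by move=> x y Jx Jy v n; rewrite scalerBl (projB prNP); apply: (addsubgroupB (sg_mN _ _)).
by move=> a x Jx v n; rewrite mulrC -scalerA.
Qed.

Let J0 s : J 0 s.
Proof. by move=> v n; apply: mN0; apply: (proj_in prNP). Qed.

Let Z s := (exists2 a, m a & s = iota (alpha a)) \/ s \in ys.

(** An element of [m] raises the exponent by one. An element of [ys] raises the degree instead, and
    [K.+1 - b n] equals [K - b (n - 1)] wherever [Ng (n - 1)] can be nonzero. *)
Let ZJ K x s : Z x -> J K s -> J K.+1 (x * s).
Proof.
move=> Zx Js v n; rewrite -scalerA; case: Zx => [[a ma ->]|yy].
  have := act_proj n a (s *: v); rewrite {1}/act => ->.
  by apply: mN_leq (mN_act ma (Js v n)); lia.
have -> : n = 1%:Z + (n - 1) by lia.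
rewrite (proj_scale gradN prNP _ _ (ys1 yy)).
have [lt|ge] := ltP (n - 1 + c%:Z) 0.
  by rewrite (Ng_neg lt (proj_in prNP _ _)) scaler0; apply: (addsubgroup0 (sg_mN _ _)).
rewrite [1%:Z + _]addrC; apply: mN_leq (mN_mul yy (Js v (n - 1))).
by rewrite /b; do 2 case: ifP; lia.
Qed.

Let actS (a : A) (s : S) := iota (alpha a) * s.

Let actSB a : sub_morph (actS a). Proof. by move=> x y; rewrite /actS mulrBr. Qed.

(** Modulo [I] the generators [ys] vanish, so every element of [S] comes from [A], and [m] acts as
    zero; thus [S / I] is a quotient of the residue field. *)
Let Zlen (I : S -> Prop) : ideal I -> ~ I 1 -> incl Z I -> length_le actS I (@full_pred S) 1.
Proof.
move=> [sgI mI] nI1 ZI.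
have res s : exists a, I (s - iota (alpha a)).
  elim: (genS s) => {s} [_ /S0[a ->]|y yy|s t _ [a Ia] _ [a' Ia']|s t _ [a Ia] _ [a' Ia']].
  - by exists a; rewrite subrr; apply: addsubgroup0.
  - by exists 0; rewrite !rmorph0 subr0; apply: ZI; right.
  - exists (a - a'); rewrite !rmorphB.
    have -> : s - t - (iota (alpha a) - iota (alpha a')) =
      (s - iota (alpha a)) - (t - iota (alpha a')) by ring.
    exact: addsubgroupB.
  exists (a * a'); rewrite !rmorphM.
  have -> : s * t - iota (alpha a) * iota (alpha a') =
    s * (t - iota (alpha a')) + iota (alpha a') * (s - iota (alpha a)) by ring.
  by apply: addsubgroupD => //; apply: mI.
move=> k [d [d1 [d2 [_ d4]]]]; rewrite leqNgt; apply/negP => k2.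
have [sg1 a1] := d1 1%N (ltnW k2); have [d01 [x [dx nx]]] := d4 0%N (ltnW k2).
have [_ [z [_ nz]]] := d4 1%N k2; apply: nz.
have I1 s : I s -> d 1%N s by move=> /d2/d01.
have [a Ia] := res x.
have nma : ~ m a.
  move=> ma; apply: nx; apply: d2; apply: (addsubgroup_subK sgI Ia).
  by apply: ZI; left; exists a.
have [u ua] := local_unit maxm nma.
have d11 : d 1%N 1.
  have -> : 1 = actS u (iota (alpha a)) by rewrite /actS -!rmorphM ua !rmorph1.
  by apply: a1; apply: (addsubgroup_subKr sg1 (I1 _ Ia)).
have [a' Ia'] := res z; apply: (addsubgroup_subK sg1 (I1 _ Ia')).
by rewrite -[iota _]mulr1; apply: (a1 a').
Qed.

(** [N] modulo [window n1 q] is the direct sum of the [N_n / M_n] over [q] consecutive degrees. A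
    sum of lengths thus becomes the length of one quotient of [N], to be compared with quotients of
    [S]. *)
Let window n1 q v := forall k, (k < q)%N -> Mn (n1 + k%:Z) (prN (n1 + k%:Z) v).

Let window_submod n1 q : submod_act act (window n1 q).
Proof.
split; first split.
- by move=> k _; rewrite (sub_morph0 (projB prNP _)); apply: (stable_addsubgroup _ stM).1.
- move=> x y Hx Hy k kq; rewrite (projB prNP); apply: addsubgroupB; last exact: Hy.
    exact: (stable_addsubgroup _ stM).
  exact: Hx.
by move=> a x Hx k kq; rewrite act_proj; apply: (stable_act _ stM); apply: Hx.
Qed.

Let window_length n1 q : quot_length act (window n1 q) (@full_pred N) (\sum_(k < q) len (n1 + k%:Z)).
Proof.
elim: q => [|q IHq].
  by rewrite big_ord0; apply: quot_length_refl => // x _ k.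
have sub x : window n1 q.+1 x -> window n1 q x by move=> Hx k kq; apply: Hx; apply: ltnW.
rewrite big_ord_recr /= addnC; apply: (quot_length_add actB) IHq => //.
suff H : quot_length act (window n1 q.+1) (window n1 q) (len (n1 + q%:Z)) <->
  quot_length act (Mn (n1 + q%:Z)) (Ng (n1 + q%:Z)) (len (n1 + q%:Z)) by apply/H; apply: lenP.
apply: (quot_length_iso (f := prN (n1 + q%:Z))) => //.
- exact: projB prNP _.
- by move=> x Hx; split; [apply: sub | apply: Hx].
- move=> y Ny; exists y.
    move=> k kq; rewrite (proj_ne prNP _ Ny); first exact: (stable_addsubgroup _ stM).1.
    by rewrite (inj_eq (addrI _)) eqz_nat gtn_eqF.
  by rewrite (proj_id prNP Ny) subrr; apply: (stable_addsubgroup _ stM).1.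
- move=> x Hx Mx k; rewrite ltnS leq_eqVlt => /predU1P[-> //|]; exact: Hx.
- by move=> x _; apply: (proj_in prNP).
- exact: stM.1.
exact: MnNg.
Qed.

Lemma length_sum_bound : exists d C, krull_dim_ge S d /\ forall n1 q K,
  (forall k, (k < q)%N -> (l0.+1 * b (n1 + k%:Z) <= K)%N) ->
  (\sum_(k < q) len (n1 + k%:Z) <= C * K.+1 ^ d)%N.
Proof.
have id0 : ideal (fun s : S => s = 0).
  split; first by split=> // x y -> ->; rewrite subrr.
  by move=> a x ->; rewrite mulr0.
have n01 : ~ (1 = 0 :> S) by apply/eqP; apply: oner_neq0.
have actSM a s t : actS a (s * t) = s * actS a t by rewrite /actS mulrCA.
have [C [d [gr [ch [ch1 ch2 _]]]]] := growth_of_ideal actSM actSB noeS idJ J0 ZJ Zlen id0 n01.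
(* [N] is exhausted by [size hsN] cyclic layers, each contributing at most the length of
   [S / J K]. *)
exists d, (size hsN * C)%N; split; first by exists ch.
move=> n1 q K hK.
(* From [l0.+1 * b <= K] the exponent [K - b] is at least [l0 * b], enough to land in [M]. *)
have JW s v : J K s -> window n1 q (s *: v).
  by move=> Js k kq; apply: mN_Mn (Js v _); have := hK k kq; rewrite mulSn; lia.
pose fix span (hs : seq (int * N)) : N -> Prop :=
  if hs is h :: hs' then sum_pred (span hs') (fun v => exists s, v = s *: h.2) else fun v => v = 0.
have span_sub hs : submod_act act (span hs).
  elim: hs => [|h hs IHhs] /=.
    by split=> [|a x ->]; [split=> // x y -> ->; rewrite subrr | rewrite (sub_morph0 (actB a))].
  apply: (submod_sum_pred actB) => //; split=> [|a _ [s ->]]; last first.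
    by exists (actS a s); rewrite /act scalerA.
  split; first by exists 0; rewrite scale0r.
  by move=> _ _ [s ->] [t ->]; exists (s - t); rewrite scalerBl.
have span_scale hs s v : span hs v -> span hs (s *: v).
  elim: hs v => [v ->|h hs IHhs _ [x [_ [hx [t ->] ->]]]] /=; first by rewrite scaler0.
  exists (s *: x), ((s * t) *: h.2); rewrite scalerDr scalerA; split=> //; first exact: IHhs.
  by exists (s * t).
have span_gen hs h : h \in hs -> span hs h.2.
  elim: hs => // h' hs IHhs; rewrite inE => /predU1P[->|/IHhs hh] /=.
    by apply: sum_predr; [case: (span_sub hs) | exists 1; rewrite scale1r].
  apply: sum_predl => //; split; first by exists 0; rewrite scale0r.
  by move=> _ _ [s ->] [t ->]; exists (s - t); rewrite scalerBl.
have span_len hs : length_le act (window n1 q) (sum_pred (window n1 q) (span hs))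
    (size hs * (C * K.+1 ^ d)).
  have sW hs' := submod_sum_pred actB (window_submod n1 q) (span_sub hs').
  have [sgW _] := window_submod n1 q.
  elim: hs => [|h hs IHhs] /=.
    rewrite mul0n; apply: length_le_refl => //; last by move=> _ [x [_ [Wx -> ->]]]; rewrite addr0.
    by move=> x Wx; apply: sum_predl => //; case: (span_sub [::]).
  rewrite mulSn addnC; apply: (length_le_add actB) IHhs _ => //.
  - exact: (sW (h :: hs)).
  - by move=> x Wx; apply: sum_predl => //; case: (span_sub hs).
  - move=> _ [x [y [Wx hy ->]]]; exists x, y; split=> //; apply: sum_predl => //.
    by split; [exists 0; rewrite scale0r | move=> _ _ [s ->] [t ->]; exists (s - t); rewrite scalerBl].
  apply: (length_le_image (f := fun s : S => s *: h.2)) (gr K) => //.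
  - by move=> s t; rewrite scalerBl.
  - by move=> a s; rewrite /act scalerA.
  - move=> _ [_ [s [-> Js ->]]]; rewrite add0r; split=> //.
    by apply: sum_predl; [case: (span_sub hs) | apply: JW].
  move=> _ [x [_ [Wx [y [_ [hy [s ->] ->]]] ->]]]; exists s => //.
  by exists x, y; rewrite addrA addrK.
apply: leq_trans (span_len hsN (\sum_(k < q) len (n1 + k%:Z))%N _) _; last by rewrite mulnA.
apply: chain_sub (window_length n1 q).1 => // v _; apply: sum_predr.
  by case: (window_submod n1 q).
by apply: hsN_gen; [case: (span_sub hsN) | exact: span_scale | exact: span_gen].
Qed.

Lemma hilbert_polynomial_degree (P : {poly rat}) (n0 : int) :
  (forall n : int, n0 <= n -> P.[n%:~R] = (len n)%:R) ->
  exists d, krull_dim_ge S d /\ (size P <= d)%N.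
Proof.
move=> Plen; have [d [C [kd bd]]] := length_sum_bound; exists d; split=> //.
(* For [k < n] one has [b (n + k) = n + k + c <= 2 n + c], so [K = l0.+1 * (2 n + c)] serves the
   whole window; the constants are those of [K.+1]. *)
apply: (@poly_growth P (fun n => len n%:Z) `|n0|%N d C (l0.+1 * 2) (l0.+1 * c).+1) => n le.
  by rewrite -Plen //; lia.
rewrite addnS -mulnA -mulnDr; under eq_bigr do rewrite PoszD.
apply: bd => k kn; have pos : 0 <= n%:Z + k%:Z + c%:Z by lia.
have bk : b (n%:Z + k%:Z) = (n + k + c)%N by rewrite /b pos; lia.
by rewrite leq_mul2l bk; lia.
Qed.

End LocalCase.

Lemma hilbert_polynomial_exists : (forall n, exists l, quot_length act (Mn n) (Ng n) l) ->
  exists (P : {poly rat}) (n0 : int), forall n : int, n0 <= n ->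
    exists l, quot_length act (Mn n) (Ng n) l /\ P.[n%:~R] = l%:R.
Proof.
exact: (top_hilbert_polynomial actB actBl actA act1 linX linY commXX commXY commYY stM YM FNg NgF noeA).
Qed.

End Main.

Theorem theorem5p1
  (A R S : comRingType)
  (alpha : {rmorphism A -> R}) (iota : {rmorphism R -> S})
  (Rg : nat -> R -> Prop) (Sg : nat -> S -> Prop)
  (M : lmodType R) (N : lmodType S)
  (Mg : int -> M -> Prop) (Ng : int -> N -> Prop)
  (j : M -> N) :
  noetherian A ->
  (* R and S are standard graded with R_0 = S_0 = A *)
  standard_graded Rg -> standard_graded Sg ->
  injective alpha -> (forall r, Rg 0%N r <-> exists a, r = alpha a) ->
  (forall s, Sg 0%N s <-> exists a, s = iota (alpha a)) ->
  (* R ⊆ S is an inclusion of graded rings *)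
  injective iota -> (forall n r, Rg n r -> Sg n (iota r)) ->
  (* M, N finitely generated graded modules *)
  graded_module Rg Mg -> fg_module M ->
  graded_module Sg Ng -> fg_module N ->
  (* M ⊆ N is an inclusion of graded R-modules *)
  injective j -> (forall x y, j (x - y) = j x - j y) ->
  (forall r x, j (r *: x) = iota r *: j x) ->
  (forall n x, Mg n x -> Ng n (j x)) ->
  let actN := fun (a : A) (x : N) => iota (alpha a) *: x in
  let Mimg := fun x : N => exists m, x = j m in
  let Mimg_n := fun n (x : N) => exists m, Mg n m /\ x = j m in
  (* (1) Ass_A(N/M) is finite *)
  (exists (ps : nat -> A -> Prop) (k : nat), forall p, ass_quot actN Mimg p ->
      exists i, (i < k)%N /\ forall a, p a <-> ps i a) /\
  (* (2) Hilbert polynomial of the lengths ℓ_A(N_n/M_n) *)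
  (local_ring A ->
   (forall n : int, exists l, quot_length actN (Mimg_n n) (Ng n) l) ->
   exists P : {poly rat},
     (exists d, krull_dim_ge S d /\ (size P <= d)%N) /\
     exists n0 : int, forall n : int, n0 <= n ->
       exists l, quot_length actN (Mimg_n n) (Ng n) l /\ P.[n%:~R] = l%:R).
Proof.
move=> noeA [_ [gradR [xs [xs1 genR]]]] [noeS [gradS [ys [ys1 genS]]]] _ R0 S0 _ iotag.
move=> gradM fgM gradN fgN _ jB jZ jg actN Mimg Mimg_n.
have [prN prNP] := projections_exist gradN.1 gradN.2.1.
have [prM prMP] := projections_exist gradM.1 gradM.2.1.
have [prS prSP] := projections_exist gradS.1 gradS.2.1.
have [prR prRP] := projections_exist gradR.1 gradR.2.1.
have [hsN [hsNg hsN_gen]] := homogeneous_generators prNP fgN.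
have [hsM [hsMg hsM_gen]] := homogeneous_generators prMP fgM.
split.
  have [ps psP] := ass_finite noeA gradR gradS xs1 ys1 genR genS R0 S0 iotag gradM gradN jB jZ jg
    prNP prMP prSP prRP hsNg hsMg hsN_gen hsM_gen.
  exists (fun i => List.nth i ps (fun=> False)), (List.length ps) => p /psP[q qps pq].
  have [i [/ssrnat.ltP isz iq]] := List.In_nth _ _ (fun=> False) qps.
  by exists i; rewrite iq.
move=> [m [idm [nm1 maxm]]] fin.
have [P [n0 HP]] := hilbert_polynomial_exists noeA gradR gradS xs1 ys1 genR genS R0 S0 iotag gradM gradN
  jB jZ jg prNP prMP prSP prRP hsNg hsMg hsN_gen hsM_gen fin.
have [len lenP] := choice fin.
exists P; split; last by exists n0.
have degree := hilbert_polynomial_degree gradR gradS xs1 ys1 genR genS R0 S0 gradM gradN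
  jB jZ jg prNP prMP prSP prRP hsNg hsMg hsN_gen hsM_gen noeS idm nm1 maxm lenP.
apply: (degree P n0) => n /HP[l [ql ->]].
by rewrite (quot_length_unique ql (lenP n)).
Qed.
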